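(* Let $\tilde f:\mathbb{R}^p\to\mathbb{R}$, $\tilde g:\mathbb{R}^p\to\mathbb{R}\cup\{+\infty\}$ and $\varphi:=\tilde f+\tilde g$ satisfy: (1) $\varphi$ is lower bounded and $\min_{\boldsymbol{s}\in\mathbb{R}^p}\varphi(\boldsymbol{s})$ has a solution; (2) $\tilde f$ is $L$-smooth and $\tilde f+\frac{\ell}{2}\|\cdot\|^2$ is convex for some $\ell\in\mathbb{R}$; (3) $\tilde g$ is proper, lower semicontinuous and prox-bounded. Let $(\boldsymbol{u}^k,\boldsymbol{v}^k,\boldsymbol{s}^k)$ be generated by the randomised block-coordinate Douglas--Rachford splitting method with step-size $\gamma>0$, where at each iteration $k$ the set $\mathcal{C}^k\subseteq[p]$ of updated coordinates is chosen uniformly at random. Suppose $|\mathcal{C}^k|=|\mathcal{C}|$ for all $k$, where $\frac p2+\delta<|\mathcal{C}|\le p$ for some $\delta>0$, and $\gamma>0$ is sufficiently small such that $$(1+\gamma L)^2+\gamma L^2+\frac{5\gamma\ell}{2}+(1+\gamma)(1+\gamma\ell)^2\Bigl(1-\frac{|\mathcal{C}|}{p}\Bigr)-\frac32<0 .$$ Let $$\mathcal{L}_\gamma(\boldsymbol{u},\boldsymbol{v},\boldsymbol{s}):=\tilde f(\boldsymbol{u})+\tilde g(\boldsymbol{v})+\frac1\gamma\langle \boldsymbol{s}-\boldsymbol{u},\boldsymbol{v}-\boldsymbol{u}\rangle-\frac{1}{2\gamma}\|\boldsymbol{v}-\boldsymbol{u}\|^2 .$$ Then: (i) the limit of the random sequence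 $\mathcal{L}^k:=\mathcal{L}_\gamma(\boldsymbol{u}^k,\boldsymbol{v}^k,\boldsymbol{s}^k)$ exists and is bounded with probability one, i.e. $\lim_{k\to\infty}\mathcal{L}^k=\mathcal{L}^*<\infty$ almost surely; (ii) the sequence of random variables $\|\boldsymbol{v}^k-\boldsymbol{u}^k\|^2$ is summable with probability one; (iii) the random sequences $\boldsymbol{v}^k$ and $\boldsymbol{u}^k$ have, almost surely, the same limit points, all of which are stationary points of $\varphi$.
   Context: $[p]=\{1,\dots,p\}$. $\mathrm{Prox}_{\gamma h}(\boldsymbol{x}):=\arg\min_{\boldsymbol{u}}\{h(\boldsymbol{u})+\frac{1}{2\gamma}\|\boldsymbol{u}-\boldsymbol{x}\|^2\}$ (set-valued). A function is $L$-smooth if it is differentiable with $L$-Lipschitz gradient. $h$ is prox-bounded if there exists $\gamma_h>0$ such that $h+\frac{1}{2\gamma}\|\cdot\|^2$ is lower bounded for all $\gamma\in(0,\gamma_h)$. A stationary point of $\varphi$ is a point $\boldsymbol{u}^*$ with $\boldsymbol{0}\in\partial\varphi(\boldsymbol{u}^* )$ (limiting subdifferential). Randomised block-coordinate Douglas--Rachford splitting: starting from an arbitrary $\boldsymbol{s}^0$, for $k=1,2,\dots$, $$\boldsymbol{u}^k\in\mathrm{Prox}_{\gamma\tilde f}(\boldsymbol{s}^{k-1}),\qquad \boldsymbol{v}^k\in\mathrm{Prox}_{\gamma\tilde g}(2\boldsymbol{u}^k-\boldsymbol{s}^{k-1}),\qquad \boldsymbol{s}^k=\boldsymbol{s}^{k-1}+\sum_{j\in\mathcal{C}^k}[\boldsymbol{v}^k-\boldsymbol{u}^k]_j\,\boldsymbol{e}_j,$$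 where $[\boldsymbol{a}]_j$ is the $j$-th component of $\boldsymbol{a}$ and $\boldsymbol{e}_j$ the corresponding unit vector. The set $\mathcal{C}^k$ is drawn uniformly at random among subsets of $[p]$ of size $|\mathcal{C}|$ (so that $\mathbb{P}(j\in\mathcal{C}^k)=|\mathcal{C}|/p$ for every $j\in[p]$), independently of the past of the algorithm. *)

(* Defs.v *)
From HB Require Import structures.
From mathcomp Require Import all_boot all_order all_algebra.
From mathcomp Require Import all_classical all_reals all_analysis.

Set Implicit Arguments.
Unset Strict Implicit.
Unset Printing Implicit Defensive.

Import Order.TTheory GRing.Theory Num.Theory.
Import numFieldNormedType.Exports.

Local Open Scope classical_set_scope.
Local Open Scope ring_scope.

Section Euclidean.
Context {R : realType} {p : nat}.
Implicit Types x y : 'rV[R]_p.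

Definition dotv x y : R := \sum_(j < p) x 0 j * y 0 j.

(* The library norm `|x| on 'rV[R]_p is the sup norm; it induces the same
   topology, so the library notions of limit and differentiability apply. *)
Definition enorm x : R := Num.sqrt (dotv x x).

Definition gradient (f : 'rV[R]_p -> R) x : 'rV[R]_p :=
  \row_j 'D_(delta_mx 0 j) f x.

Definition L_smooth (L : R) (f : 'rV[R]_p -> R) : Prop :=
  (forall x, differentiable f x) /\
  (forall x y, enorm (gradient f x - gradient f y) <= L * enorm (x - y)).

End Euclidean.

(* Extended-real-valued functions h : R^p -> R U {+oo} are rendered as
   functions to \bar R, and [proper_efun] excludes the value -oo. *)
Section Variational.
Context {R : realType} {p : nat}.
Implicit Types (h : 'rV[R]_p -> \bar R) (x v : 'rV[R]_p).
Local Open Scope ereal_scope.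

Definition proper_efun h : Prop :=
  (forall x, h x != -oo) /\ (exists x, h x \is a fin_num).

Definition lower_bounded h : Prop := exists m : R, forall x, m%:E <= h x.

(* This agrees with the convention argmin (+oo) = empty for every h that takes
   some finite value. *)
Definition argmin h : set 'rV[R]_p := [set x | forall y, h x <= h y].

Definition prox (gamma : R) h x : set 'rV[R]_p :=
  argmin (fun u => h u + ((2 * gamma)^-1 * enorm (u - x) ^+ 2)%:E).

Definition prox_bounded h : Prop :=
  exists2 gamma_h : R, (0 < gamma_h)%R &
    forall gamma : R, (0 < gamma < gamma_h)%R ->
      lower_bounded (fun u => h u + ((2 * gamma)^-1 * enorm u ^+ 2)%:E).

(* Frechet (regular) subdifferential: h x is finite and
   liminf_(y -> x, y != x) (h y - h x - <v, y - x>) / |y - x| >= 0. *)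
Definition frechet_subdiff h x : set 'rV[R]_p :=
  [set v | h x \is a fin_num /\
     0 <= limf_einf
       (fun y => (h y - h x - (dotv v (y - x))%:E) * ((enorm (y - x))^-1)%:E)
       x^'].

(* Limiting (Mordukhovich) subdifferential. *)
Definition limiting_subdiff h x : set 'rV[R]_p :=
  [set v | h x \is a fin_num /\
     exists xn vn : nat -> 'rV[R]_p,
       [/\ xn n @[n --> \oo] --> x,
           h (xn n) @[n --> \oo] --> h x,
           forall n, frechet_subdiff h (xn n) (vn n) &
           vn n @[n --> \oo] --> v]].

Definition stationary h : set 'rV[R]_p := [set x | limiting_subdiff h x 0%R].

End Variational.

Section BlockCoordinateDRS.
Context {R : realType} {p : nat} {d : measure_display} {T : measurableType d}.
Implicit Types (u v s : nat -> T -> 'rV[R]_p) (C : nat -> T -> {set 'I_p}).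

(* Everything generated before C^k is drawn: u^i, v^i for 1 <= i <= k and C^i
   for 1 <= i < k.  The iterates s^0, ..., s^(k-1) are functions of these. *)
Definition past u v C (k : nat) : set (set T) :=
  <<s \bigcup_(i in [set i | (0 < i <= k)%N]) \bigcup_(j in [set: 'I_p])
        ([set (fun w => u i w 0 j) @^-1` B | B in @measurable _ R] `|`
         [set (fun w => v i w 0 j) @^-1` B | B in @measurable _ R])
      `|`
      \bigcup_(i in [set i | (0 < i < k)%N])
        [set C i @^-1` [set S] | S in [set: {set 'I_p}]] >>.

(* u, v, C are indexed from 1 (index 0 is unconstrained), s from 0.  The
   measurability fields say that u^k, v^k, C^k are random variables; in
   particular the selections from the set-valued Prox are measurable. *)
Record rand_DRS (P : probability T R) (f : 'rV[R]_p -> R)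
    (g : 'rV[R]_p -> \bar R) (gamma : R) (c : nat) (s0 : 'rV[R]_p)
    u v s C : Prop := RandDRS {
  drs_init : forall w, s 0 w = s0;
  drs_u : forall k w, prox gamma (EFin \o f) (s k w) (u k.+1 w);
  drs_v : forall k w, prox gamma g (2 *: u k.+1 w - s k w) (v k.+1 w);
  drs_s : forall k w, s k.+1 w =
    s k w + \sum_(j in C k.+1 w) (v k.+1 w - u k.+1 w) 0 j *: delta_mx 0 j;
  drs_meas_u : forall k j, measurable_fun setT (fun w => u k.+1 w 0 j);
  drs_meas_v : forall k j, measurable_fun setT (fun w => v k.+1 w 0 j);
  drs_meas_C : forall k S, measurable (C k.+1 @^-1` [set S]);
  drs_card_C : forall k w, #|C k.+1 w| = c;
  drs_unif_C : forall k (S : {set 'I_p}), #|S| = c ->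
    P (C k.+1 @^-1` [set S]) = (('C(p, c)%:R)^-1)%:E;
  drs_indep_C : forall k (A : set T) (S : {set 'I_p}), past u v C k.+1 A ->
    P (A `&` C k.+1 @^-1` [set S]) = (P A * P (C k.+1 @^-1` [set S]))%E
}.

End BlockCoordinateDRS.

Definition Lagr {R : realType} {p : nat} (f : 'rV[R]_p -> R)
    (g : 'rV[R]_p -> \bar R) (gamma : R) (u v s : 'rV[R]_p) : \bar R :=
  ((f u)%:E + g v + (gamma^-1 * dotv (s - u) (v - u))%:E
   - ((2 * gamma)^-1 * enorm (v - u) ^+ 2)%:E)%E.

(* Main.v *)
Require Import Defs.
From HB Require Import structures.
From mathcomp Require Import all_boot all_order all_algebra.
From mathcomp Require Import all_classical all_reals all_analysis.
From mathcomp Require Import measurable_realfun ring lra.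

Set Implicit Arguments.
Unset Strict Implicit.
Unset Printing Implicit Defensive.

Import Order.TTheory GRing.Theory Num.Theory.
Import numFieldNormedType.Exports.

Local Open Scope classical_set_scope.
Local Open Scope ring_scope.

(* Write x = gamma L, y = gamma l, r^k = v^k - u^k, and let E_k be the
   forward-backward envelope
     f(u^k) + <grad f(u^k), v^k - u^k> + g(v^k) + |r^k|^2 / (2 gamma),
   so that the Lagrangian at step k is E_k - |r^k outside C^k|^2 / gamma.
   Cocoercivity of grad f + l id gives, for every realisation of C^k,
     gamma (E_{k+1} - E_k) <= - c1 |r^k on C^k|^2 + c2 |r^k outside C^k|^2
   with 0 <= c2 <= c1 and 0 < c1.  Each coordinate is updated with probability
   c/p > 1/2 independently of r^k, so taking expectations of the telescoped
   inequality bounds the sum of the E|r^k|^2, and |r^k|^2 is almost surely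
   summable.  No martingale convergence theorem is needed: on each path with
   summable |r^k|^2, E_k is bounded below and decreasing up to a summable error,
   hence converges, and the optimality conditions of the two proximal steps pass
   to the limit. *)

(** * Euclidean inner product and smooth functions *)

Section EuclideanTheory.
Context {R : realType} {p : nat}.
Implicit Types (x y z : 'rV[R]_p) (a : R).

Lemma dotvC x y : dotv x y = dotv y x.
Proof. by apply: eq_bigr => j _; rewrite mulrC. Qed.

Lemma dotvDl x y z : dotv (x + y) z = dotv x z + dotv y z.
Proof. by rewrite /dotv -big_split; apply: eq_bigr => j _; rewrite mxE mulrDl. Qed.

Lemma dotvZl a x y : dotv (a *: x) y = a * dotv x y.
Proof. by rewrite /dotv mulr_sumr; apply: eq_bigr => j _; rewrite mxE mulrA. Qed.

Lemma dotvNl x y : dotv (- x) y = - dotv x y.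
Proof. by rewrite -scaleN1r dotvZl mulN1r. Qed.

Lemma dotvDr x y z : dotv x (y + z) = dotv x y + dotv x z.
Proof. by rewrite dotvC dotvDl !(dotvC x). Qed.

Lemma dotvZr a x y : dotv x (a *: y) = a * dotv x y.
Proof. by rewrite dotvC dotvZl dotvC. Qed.

Lemma dotvNr x y : dotv x (- y) = - dotv x y.
Proof. by rewrite dotvC dotvNl dotvC. Qed.

Lemma dotv0r x : dotv x 0 = 0.
Proof. by rewrite -(scale0r 0) dotvZr mul0r. Qed.

Definition dotvE := (dotvDl, dotvDr, dotvNl, dotvNr, dotvZl, dotvZr).

Lemma dotv_ge0 x : 0 <= dotv x x.
Proof. by apply: sumr_ge0 => j _; rewrite -expr2 sqr_ge0. Qed.

Lemma dotv_eq0 x : dotv x x = 0 -> x = 0.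
Proof.
move=> /eqP; rewrite psumr_eq0; last by move=> j _; rewrite -expr2 sqr_ge0.
move=> /allP x0; apply/rowP => j; rewrite mxE.
by apply/eqP; rewrite -sqrf_eq0 expr2; apply: x0; rewrite mem_index_enum.
Qed.

Lemma sqr_enorm x : enorm x ^+ 2 = dotv x x.
Proof. by rewrite sqr_sqrtr ?dotv_ge0. Qed.

Lemma enorm_ge0 x : 0 <= enorm x.
Proof. exact: sqrtr_ge0. Qed.

Lemma enorm_gt0 x : x != 0 -> 0 < enorm x.
Proof.
move=> x0; rewrite lt_neqAle enorm_ge0 andbT eq_sym.
by apply: contra_neq x0 => e0; apply: dotv_eq0; rewrite -sqr_enorm e0 expr0n.
Qed.

(** Expand the square [|a x - y|^2 >= 0] and divide by [a]. *)
Lemma dotv_young x y a : 0 < a ->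
  2 * dotv x y <= a * dotv x x + a^-1 * dotv y y.
Proof.
move=> a0; have := dotv_ge0 (a *: x - y); rewrite !dotvE (dotvC y x) => h.
have : 0 <= a^-1 * (a * (a * dotv x x) - a * dotv x y - (a * dotv x y - dotv y y)).
  by rewrite mulr_ge0 ?invr_ge0 ?(ltW a0) //; lra.
have -> : a^-1 * (a * (a * dotv x x) - a * dotv x y - (a * dotv x y - dotv y y))
  = a * dotv x x + a^-1 * dotv y y - 2 * dotv x y by field; rewrite gt_eqF.
by lra.
Qed.

(* A form of Cauchy-Schwarz that avoids square roots. *)
Lemma dotv_le_of_sqr x y a : 0 <= a ->
  dotv x x <= a ^+ 2 * dotv y y -> dotv x y <= a * dotv y y.
Proof.
rewrite le_eqVlt => /predU1P[<-|a0] h.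
  have -> : x = 0.
    by apply: dotv_eq0; apply/eqP; rewrite eq_le dotv_ge0 andbT (le_trans h) ?lexx// expr0n mul0r.
  by rewrite dotvC dotv0r mul0r.
have ai0 : 0 < a^-1 by rewrite invr_gt0.
have := dotv_young x y ai0; rewrite invrK.
have : a^-1 * dotv x x <= a^-1 * (a ^+ 2 * dotv y y) by rewrite ler_wpM2l // ltW.
have -> : a^-1 * (a ^+ 2 * dotv y y) = a * dotv y y by field; rewrite gt_eqF.
by lra.
Qed.

Lemma dotv_entry_le x j : x 0 j ^+ 2 <= dotv x x.
Proof.
rewrite /dotv (bigD1 j) //= -expr2 lerDl.
by apply: sumr_ge0 => i _; rewrite -expr2 sqr_ge0.
Qed.

Lemma normr_le_enorm x : `|x| <= enorm x.
Proof.
have [->|x0] := eqVneq `|x| 0; first exact: enorm_ge0.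
have [[i j] xij] := mx_norm_neq0 x0.
rewrite [leLHS]xij -(@ler_pXn2r _ 2) ?nnegrE ?enorm_ge0 ?normr_ge0//.
by rewrite sqr_enorm real_normK ?num_real//= ord1; exact: dotv_entry_le.
Qed.

Lemma cvg_dotv {I : Type} {F : set_system I} {FF : Filter F}
    (xn yn : I -> 'rV[R]_p) x y :
  xn n @[n --> F] --> x -> yn n @[n --> F] --> y ->
  dotv (xn n) (yn n) @[n --> F] --> dotv x y.
Proof.
move=> xnx yny; rewrite /dotv.
apply: cvg_big => [|j _]; first exact: add_continuous.
have c := @coord_continuous R 1 p 0 j.
have cvx z (zn : I -> 'rV[R]_p) : zn n @[n --> F] --> z -> zn n 0 j @[n --> F] --> z 0 j.
  exact: continuous_cvg (c z).
by apply: cvgM; exact: cvx.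
Qed.

(** Bridges the Euclidean estimates of the proof and the topology of ['rV[R]_p], which comes from
    the sup norm: the sup norm is dominated by [enorm]. *)
Lemma cvg_enorm0 {I : Type} {F : set_system I} {FF : Filter F} (xn : I -> 'rV[R]_p) :
  enorm (xn n) ^+ 2 @[n --> F] --> 0 -> xn n @[n --> F] --> (0 : 'rV[R]_p).
Proof.
move=> h; apply/cvgr0Pnorm_le => e e0.
have e20 : 0 < e ^+ 2 by rewrite exprn_gt0.
move/cvgr0Pnorm_le : h => /(_ _ e20); apply: filterS => n.
rewrite ger0_norm ?sqr_ge0// ler_pXn2r ?nnegrE ?enorm_ge0 ?(ltW e0)//.
exact: le_trans (normr_le_enorm _).
Qed.

End EuclideanTheory.

Section GradientTheory.
Context {R : realType} {p : nat}.
Implicit Types (f : 'rV[R]_p -> R) (x y d : 'rV[R]_p).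

Lemma derive_gradient f x d : differentiable f x ->
  'D_d f x = dotv (gradient f x) d.
Proof.
move=> fx; rewrite deriveE// [d in LHS]row_sum_delta linear_sum /dotv.
apply: eq_bigr => j _; rewrite linearZ/= mxE -deriveE//.
by rewrite -[LHS]/(_ * _) mulrC.
Qed.

Lemma is_derive_line f x d (t : R) : differentiable f (t *: d + x) ->
  is_derive t 1 (fun a : R => f (a *: d + x)) (dotv (gradient f (t *: d + x)) d).
Proof.
move=> fx; rewrite -derive_gradient//.
have E : (fun h : R => h^-1 *: (f ((h *: 1 + t) *: d + x) - f (t *: d + x))) =
         (fun h : R => h^-1 *: (f (h *: d + (t *: d + x)) - f (t *: d + x))).
  by apply/funext => h; rewrite scalerDl addrA -[h *: 1]/(h * 1) mulr1.
have dv : derivable f (t *: d + x) d by exact: diff_derivable.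
apply: DeriveDef; first by rewrite /derivable /= E; exact: dv.
by rewrite /derive /= E.
Qed.

Lemma L_smooth_sqr (L : R) f x y : L_smooth L f ->
  dotv (gradient f x - gradient f y) (gradient f x - gradient f y)
    <= L ^+ 2 * dotv (x - y) (x - y).
Proof.
move=> [_ /(_ x y) h]; rewrite -!sqr_enorm -exprMn.
by rewrite ler_pXn2r ?nnegrE ?enorm_ge0//; exact: le_trans (enorm_ge0 _) h.
Qed.

Lemma descent_lemma (L : R) f x y : 0 <= L -> L_smooth L f ->
  f y <= f x + dotv (gradient f x) (y - x) + L / 2 * dotv (y - x) (y - x).
Proof.
move=> L0 fL; set d := y - x; set G := gradient f x.
pose psi (t : R) := f (t *: d + x) - t * dotv G d - t ^+ 2 * (L / 2 * dotv d d).
have dpsi (t : R) : is_derive t 1 psi (dotv (gradient f (t *: d + x)) d - dotv G d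
    - (2 * t) * (L / 2 * dotv d d)).
  have h := is_derive_line (fL.1 (t *: d + x)).
  rewrite /psi; apply: is_deriveB => //.
    apply: is_deriveB => //.
    rewrite (_ : (fun _ => _) = (fun t => dotv G d *: t)); last first.
      by apply/funext => a; rewrite mulrC.
    by apply: is_derive_eq; rewrite -[LHS]/(_ * _) mulr1.
  rewrite (_ : (fun _ => _) = (fun t => (L / 2 * dotv d d) *: (t ^+ 2))); last first.
    by apply/funext => a; rewrite mulrC.
  apply: is_derive_eq; rewrite -![_ *: _]/(_ * _). by ring.
have le0 : psi 1 <= psi 0.
  apply: (@ler0_derive1_le_cc _ psi 0 1); rewrite ?in_itv/= ?ler01 ?lexx//.
  - move=> t; rewrite in_itv/= => /andP[t0 t1].
    rewrite derive1E (@derive_val _ _ _ _ _ _ _ (dpsi t)).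
    have := L_smooth_sqr (t *: d + x) x fL; rewrite addrK dotvZl dotvZr => hL.
    have : dotv (gradient f (t *: d + x) - G) d <= L * t * dotv d d.
      apply: dotv_le_of_sqr; first by rewrite mulr_ge0// ltW.
      by rewrite exprMn -mulrA expr2 -(mulrA t).
    by rewrite dotvDl dotvNl; lra.
  - by apply: derivable_within_continuous => t _; have := dpsi t; case.
have := le0; rewrite /psi expr1n expr0n/= !mul1r !mul0r !subr0 scale0r add0r scale1r.
by rewrite /d subrK; lra.
Qed.

(** Convexity between [x] and [d + x] at parameter [h], divided by [h], bounds the difference
    quotient of [f] by [b h]; let [h] decrease to 0. *)
Lemma hypoconvex_lower_bound (l : R) f x y :
  differentiable f x ->
  convex_function setT (fun x => f x + l / 2 * enorm x ^+ 2) ->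
  f x + dotv (gradient f x) (y - x) - l / 2 * dotv (y - x) (y - x) <= f y.
Proof.
move=> fx cvx; set G := gradient f x.
have [d ->] : exists d, y = d + x by exists (y - x); rewrite subrK.
rewrite addrK.
pose b (h : R) := f (d + x) - f x + l / 2 * (1 - h) * dotv d d.
have lim1 : h^-1 *: (f (h *: d + x) - f x) @[h --> 0^'+] --> dotv G d.
  rewrite -derive_gradient//.
  have dv : derivable f x d by exact: diff_derivable.
  exact: cvg_dnbhs_at_right dv.
have lim2 : b h @[h --> 0^'+] --> b 0.
  apply: cvg_at_right_filter; apply: cvgD; first exact: cvg_cst.
  by apply: cvgMl; apply: cvgMr; apply: cvgB; [exact: cvg_cst|exact: cvg_id].
suff : dotv G d <= b 0 by rewrite /b subr0 mulr1; lra.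
apply: (ler_cvg_to lim1 lim2); near=> h.
have h0 : 0 < h by near: h; exact: nbhs_right_gt.
have h1 : h <= 1 by near: h; apply: nbhs_right_le; exact: ltr01.
have h01 : (0 <= h <= 1) by rewrite ltW.
have /= := cvx (Itv01 (ltW h0) h1) (d + x) x (in_setT _) (in_setT _).
rewrite convRE /= /conv /= /unstable.onem.
have -> : h *: (d + x) + (1 - h) *: x = h *: d + x.
  by rewrite scalerDr scalerBl scale1r -addrA subrKC.
rewrite !sqr_enorm !dotvE (dotvC x d) => H.
rewrite -[leLHS]/(h^-1 * _) ler_pdivrMl// /b.
move: (f (d + x)) (f x) (f (h *: d + x)) H => fy fx' fh H.
lra.
Unshelve. all: by end_near. Qed.

End GradientTheory.

(** * One-step descent of the envelope *)

Section Descent.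
Context {R : realType} {p : nat}.
Implicit Types (f : 'rV[R]_p -> R) (G : 'rV[R]_p -> 'rV[R]_p).
Implicit Types (u v s x y d h w : 'rV[R]_p).

(* Baillon-Haddad for f + (l/2)|.|^2. *)
Lemma hypoconvex_cocoercive (L l : R) f G x y :
  0 <= L + l ->
  (forall x y, f y <= f x + dotv (G x) (y - x) + L / 2 * dotv (y - x) (y - x)) ->
  (forall x y, f x + dotv (G x) (y - x) - l / 2 * dotv (y - x) (y - x) <= f y) ->
  forall h, h = G y - G x + l *: (y - x) ->
  dotv h h <= (L + l) * dotv h (y - x).
Proof.
move=> Ll0 ub lb h hE.
(* The lower model at [x'] and the upper model at [y'] are compared at the trial point [y' - tau k];
   [tau] stays free to be optimised later. *)
have key x' y' tau k : k = G y' - G x' + l *: (y' - x') ->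
    f x' - f y' + dotv (G x') (y' - x') - l / 2 * dotv (y' - x') (y' - x')
    + tau * dotv k k - (L + l) / 2 * tau ^+ 2 * dotv k k <= 0.
  have [d dE] : exists d : 'rV[R]_p, d = y' - x' by exists (y' - x').
  rewrite -dE => kE.
  have zE : y' - tau *: k - x' = d - tau *: k by rewrite dE addrAC.
  have zE' : y' - tau *: k - y' = - (tau *: k) by rewrite addrAC subrr add0r.
  have := le_trans (lb x' (y' - tau *: k)) (ub y' (y' - tau *: k)).
  rewrite zE zE'.
  have kk : dotv k k = dotv (G y') k - dotv (G x') k + l * dotv d k.
    by rewrite {1}kE !dotvE.
  rewrite !dotvE (dotvC k d).
  move: kk; set kk := dotv k k; set gy := dotv (G y') k; set gx := dotv (G x') k.
  move=> kkE.
  have -> : gy = kk + gx - l * dotv d k by lra.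
  lra.
(* Adding [key] for [(x, y)] and [(y, x)] cancels the function values. *)
have sumk tau : 2 * tau * dotv h h - (L + l) * tau ^+ 2 * dotv h h <= dotv h (y - x).
  have h1 := key x y tau h hE.
  have hN : - h = G x - G y + l *: (x - y) by rewrite hE opprD -scalerN !opprB.
  have h2 := key y x tau _ hN; move: h1 h2.
  have -> : dotv h (y - x) = dotv (G y) (y - x) - dotv (G x) (y - x) + l * dotv (y - x) (y - x).
    by rewrite hE 2!dotvDl dotvNl dotvZl.
  rewrite -(opprB y x); move: (y - x) => d.
  rewrite !dotvE; lra.
(* If [L + l = 0] the bound is linear in [tau], so a large [tau] rules out [h != 0]. Otherwise
   [tau = 1 / (L + l)] is the optimal choice. *)
move: Ll0; rewrite le_eqVlt => /predU1P[K0|K0].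
  rewrite -K0 mul0r; move: sumk; rewrite -K0.
  set hd := dotv h (y - x); have := dotv_ge0 h; move: (dotv h h) => a a0 sumk.
  rewrite leNgt; apply/negP => a1.
  have tauE : 2 * ((hd + 1) / (2 * a)) * a = hd + 1 by field; rewrite gt_eqF.
  by have := sumk ((hd + 1) / (2 * a)); rewrite !mul0r subr0 tauE gerDl ler10.
have := sumk (L + l)^-1.
have -> : 2 * (L + l)^-1 * dotv h h - (L + l) * (L + l)^-1 ^+ 2 * dotv h h =
   (L + l)^-1 * dotv h h by field; rewrite gt_eqF.
by rewrite ler_pdivrMl.
Qed.

(* [D] and [H] stand for the increments of u and of gamma * grad f(u); [rC] and
   [w] for the updated and the frozen part of v - u. *)
Lemma block_drift (x y : R) (D H rC w : 'rV[R]_p) :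
  0 <= x -> - x <= y -> 0 < 1 + (x - y) / 2 ->
  0 <= 1 / 2 - y / 2 - x ^+ 2 - (x + y) / 2 ->
  D + H = rC -> dotv rC w = 0 ->
  dotv H H <= x ^+ 2 * dotv D D ->
  dotv (H + y *: D) (H + y *: D) <= (x + y) * dotv (H + y *: D) D ->
  dotv H H - (1 / 2 - y / 2) * dotv D D - 2 * dotv D w <=
  - ((1 / 2 - y / 2 - x ^+ 2 - (x + y) / 2) / (1 + x) ^+ 2) * dotv rC rC
  + (x + y) / 2 / (1 + (x - y) / 2) ^+ 2 * dotv w w.
Proof.
move=> x0 yx m0 B0 DH rw HH coco.
have [m mD] : exists m, m = (x - y) / 2 by eexists.
have [S SD] : exists S, S = (x + y) / 2 by eexists.
have [B BD] : exists B, B = 1 / 2 - y / 2 - x ^+ 2 - S by eexists.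
rewrite -mD -SD -BD in m0 B0 *.
have S0 : 0 <= S by rewrite SD; lra.
(* Cocoercivity places [H] in the ball of centre [m D] and radius [S |D|]; [e] is the offset from
   the centre. *)
have [e eD] : exists e : 'rV[R]_p, e = H - m *: D by eexists.
have ee : dotv e e <= S ^+ 2 * dotv D D.
  have mE : x = S + m by rewrite SD mD; lra.
  have yE : y = S - m by rewrite SD mD; lra.
  move: coco; rewrite eD !dotvE (dotvC D H) mE yE; lra.
(* Since [rC = (1 + m) D + e] is orthogonal to [w], only [e] contributes to [<D, w>]. This is what
   keeps the cross term small. *)
have Dw : (1 + m) * dotv D w = - dotv e w.
  by move: rw; rewrite -DH eD !dotvE; lra.
have young : - 2 * dotv D w <= S * dotv D D + S / (1 + m) ^+ 2 * dotv w w.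
  have E : - 2 * dotv D w = 2 * dotv e ((1 + m)^-1 *: w).
    rewrite dotvZr -[dotv e w]opprK -Dw; field; by rewrite gt_eqF.
  rewrite E.
  move: S0; rewrite le_eqVlt => /predU1P[S0|S0].
    have -> : e = 0.
      apply: dotv_eq0; apply/eqP; rewrite eq_le dotv_ge0 andbT.
      by rewrite (le_trans ee)// -S0 expr0n mul0r.
    by rewrite dotvC dotv0r -S0 !mul0r mulr0 addr0.
  have Si : 0 < S^-1 by rewrite invr_gt0.
  apply: (le_trans (dotv_young _ _ Si)); rewrite invrK dotvZl dotvZr lerD//.
    by rewrite ler_pdivrMl// mulrA -expr2.
  rewrite le_eqVlt; apply/orP; left; apply/eqP; field; by rewrite gt_eqF.
have rr : dotv rC rC <= (1 + x) ^+ 2 * dotv D D.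
  have := dotv_le_of_sqr x0 HH; rewrite -DH !dotvE (dotvC D H); lra.
have step : B / (1 + x) ^+ 2 * dotv rC rC <= B * dotv D D.
  rewrite -mulrA ler_wpM2l// ler_pdivrMl// exprn_gt0//; lra.
have : (1 / 2 - y / 2) * dotv D D = B * dotv D D + S * dotv D D + x ^+ 2 * dotv D D.
  by rewrite BD; ring.
lra.
Qed.

(** Here [g] is the real number g(v), not the function, so that all descent estimates take place in
    [R]. *)
Definition envelope f (g gamma : R) u v : R :=
  f u + dotv (gradient f u) (v - u) + (2 * gamma)^-1 * dotv (v - u) (v - u) + g.

(** After completing the square, the proximal objective at [2 u - s] and the envelope differ by a
    term that does not depend on [v]. *)
Lemma envelope_min f gamma g g' u v v' s : gamma != 0 ->
  s = u + gamma *: gradient f u ->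
  g + (2 * gamma)^-1 * enorm (v - (2 *: u - s)) ^+ 2 <=
  g' + (2 * gamma)^-1 * enorm (v' - (2 *: u - s)) ^+ 2 ->
  envelope f g gamma u v <= envelope f g' gamma u v'.
Proof.
move=> g0 ->; rewrite !sqr_enorm.
set G := gradient f u.
have E z : z - (2 *: u - (u + gamma *: G)) = (z - u) + gamma *: G.
  by apply/rowP => j; rewrite !mxE; ring.
rewrite !E /envelope -/G; move: (v - u) (v' - u) => a b.
have K c : (2 * gamma)^-1 * dotv (c + gamma *: G) (c + gamma *: G)
  = (2 * gamma)^-1 * dotv c c + dotv G c + gamma / 2 * dotv G G.
  by rewrite !dotvE (dotvC c G); field.
rewrite !K; lra.
Qed.

(** First replace [v'] by [v] at the base point [u'], using minimality of [v']; then move the base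
    point from [u'] to [u] with the hypoconvex lower bound. What remains is exactly the left-hand
    side of [block_drift]. *)
Lemma envelope_decrease f (gamma L l g g' : R) u v s u' v' s' rC w :
  0 < gamma -> 0 <= L ->
  (forall x y, f x + dotv (gradient f x) (y - x) - l / 2 * dotv (y - x) (y - x) <= f y) ->
  L_smooth L f -> 0 <= L + l ->
  0 < 1 + (gamma * L - gamma * l) / 2 ->
  0 <= 1 / 2 - gamma * l / 2 - (gamma * L) ^+ 2 - (gamma * L + gamma * l) / 2 ->
  s = u + gamma *: gradient f u -> s' = u' + gamma *: gradient f u' ->
  g' + (2 * gamma)^-1 * enorm (v' - (2 *: u' - s')) ^+ 2 <=
  g + (2 * gamma)^-1 * enorm (v - (2 *: u' - s')) ^+ 2 ->
  s' = s + rC -> v - u = rC + w -> dotv rC w = 0 ->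
  gamma * (envelope f g' gamma u' v' - envelope f g gamma u v) <=
  - ((1 / 2 - gamma * l / 2 - (gamma * L) ^+ 2 - (gamma * L + gamma * l) / 2)
     / (1 + gamma * L) ^+ 2) * dotv rC rC
  + (gamma * L + gamma * l) / 2 / (1 + (gamma * L - gamma * l) / 2) ^+ 2 * dotv w w.
Proof.
move=> g0 L0 lb fL Ll m0 B0 sE s'E proxv ss' vu rw.
have ge : gamma != 0 by rewrite gt_eqF.
have step1 := envelope_min ge s'E proxv.
have ub x y : f y <= f x + dotv (gradient f x) (y - x) + L / 2 * dotv (y - x) (y - x).
  exact: descent_lemma.
have [D DE] : exists D : 'rV[R]_p, D = u' - u by eexists.
have [H HE] : exists H : 'rV[R]_p, H = gamma *: (gradient f u' - gradient f u) by eexists.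
have DH : D + H = rC.
  have -> : rC = s' - s by rewrite ss' addrAC subrr add0r.
  by rewrite s'E sE DE HE; apply/rowP => j; rewrite !mxE; ring.
have HH : dotv H H <= (gamma * L) ^+ 2 * dotv D D.
  rewrite HE dotvZl dotvZr exprMn mulrA -expr2 -[leRHS]mulrA ler_wpM2l ?sqr_ge0//.
  by rewrite DE; exact: L_smooth_sqr.
have coco : dotv (H + (gamma * l) *: D) (H + (gamma * l) *: D) <=
    (gamma * L + gamma * l) * dotv (H + (gamma * l) *: D) D.
  have -> : H + (gamma * l) *: D = gamma *: (gradient f u' - gradient f u + l *: D).
    by rewrite HE [RHS]scalerDr scalerA.
  have := hypoconvex_cocoercive (x := u) (y := u') Ll ub lb (erefl _); rewrite -DE.
  move: (_ + l *: D) => h hh; rewrite !dotvE -mulrDr -!mulrA ler_pM2l//.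
  by rewrite (mulrCA _ gamma) ler_pM2l.
have drift := block_drift (mulr_ge0 (ltW g0) L0) _ m0 B0 DH rw HH coco.
apply: le_trans (drift _); last first.
  by rewrite -subr_ge0 opprK addrC -mulrDr mulr_ge0 ?(ltW g0) ?(addrC l).
have vu' : v - u' = (rC + w) - D.
  by rewrite -vu DE; apply/rowP => j; rewrite !mxE; ring.
have low := lb u' u.
have uu : u - u' = - D by rewrite DE opprB.
move: step1 low; rewrite /envelope vu' vu uu.
move: DH; rewrite addrC => /(canRL (addrK _)) HrC.
have HG : gamma * dotv (gradient f u') (rC + w) - gamma * dotv (gradient f u) (rC + w)
   = dotv H (rC + w) by rewrite HE dotvZl dotvDl dotvNl; ring.
have : dotv H H = dotv rC rC - 2 * dotv rC D + dotv D D.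
  by rewrite HrC !dotvE (dotvC D rC); ring.
have : dotv H (rC + w) = dotv rC rC - dotv rC D - dotv D w.
  by rewrite HrC !dotvE rw (dotvC D rC); ring.
move=> HrE HHE.
set E' := _ + g'; set E := _ + g => E'E; rewrite !dotvNr dotvNl opprK => low.
have quad : dotv (rC + w - D) (rC + w - D) =
    dotv (rC + w) (rC + w) + (dotv D D - 2 * dotv rC D - 2 * dotv D w).
  by rewrite !dotvE (dotvC D rC) (dotvC w D); ring.
have g2 : gamma * (2 * gamma)^-1 = 2^-1 by field.
have : gamma * E' <= gamma * E by rewrite ler_pM2l.
have : gamma * (f u' - dotv (gradient f u') D - l / 2 * dotv D D) <= gamma * f u.
  by rewrite ler_pM2l.
rewrite /E quad (dotvDr (gradient f u') (rC + w)) dotvNr HHE.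
move: HG; rewrite HrE !(mulrBr gamma) !(mulrDr gamma) !(mulrA gamma (2 * gamma)^-1) g2.
lra.
Qed.

(** The descent lemma from [u] to [v] trades the linearisation of [f] for [f v]. When [gamma L < 1],
    the envelope therefore controls both the objective at [v] and the residual. *)
Lemma envelope_lower_bound f (gamma L g : R) u v : 0 < gamma -> 0 <= L ->
  L_smooth L f ->
  f v + g + (2 * gamma)^-1 * (1 - gamma * L) * dotv (v - u) (v - u) <=
  envelope f g gamma u v.
Proof.
move=> g0 L0 fL; have := descent_lemma u v L0 fL; rewrite /envelope.
have -> : (2 * gamma)^-1 * (1 - gamma * L) * dotv (v - u) (v - u) =
  (2 * gamma)^-1 * dotv (v - u) (v - u) - L / 2 * dotv (v - u) (v - u).
  by field; rewrite gt_eqF.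
lra.
Qed.

(* First-order optimality for the proximal map of a smooth function, via the
   descent lemma instead of differentiating the proximal objective. *)
Lemma prox_smooth_gradient f (gamma L : R) u s : 0 < gamma -> 0 <= L ->
  L_smooth L f -> prox gamma (EFin \o f) s u -> s = u + gamma *: gradient f u.
Proof.
move=> g0 L0 fL pu; have ge : gamma != 0 by rewrite gt_eqF.
have [w wE] : exists w : 'rV[R]_p, w = gradient f u + gamma^-1 *: (u - s) by eexists.
suff w0 : w = 0.
  have : gamma *: w = 0 by rewrite w0 scaler0.
  rewrite wE scalerDr scalerA divff// scale1r => /eqP.
  by rewrite addrA (addrC _ u) subr_eq0 => /eqP.
(* [w] is the gradient of the proximal objective, and [u] is compared with the gradient step
   [u - t w]. Below, [t = 1 / (2 K)] makes the quadratic term half of the linear one, which forces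
   [w = 0]. *)
have key (t : R) : t * dotv w w <= (L / 2 + (2 * gamma)^-1) * t ^+ 2 * dotv w w.
  have := pu (u - t *: w); rewrite /= -!EFinD lee_fin !sqr_enorm => h1.
  have h2 := descent_lemma u (u - t *: w) L0 fL.
  have e1 : u - t *: w - s = (u - s) - t *: w by rewrite addrAC.
  have e2 : u - t *: w - u = - (t *: w) by rewrite addrAC subrr add0r.
  move: h1 h2; rewrite e1 e2; move: wE; move: (u - s) => a wE.
  have ww : dotv w w = dotv (gradient f u) w + gamma^-1 * dotv a w.
    by rewrite {1}wE dotvDl dotvZl.
  have quad : (2 * gamma)^-1 * dotv (a - t *: w) (a - t *: w) =
     (2 * gamma)^-1 * dotv a a - t * (gamma^-1 * dotv a w) + (2 * gamma)^-1 * t ^+ 2 * dotv w w.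
    by rewrite !dotvE (dotvC w a); field.
  rewrite quad !dotvE.
  have -> : gamma^-1 * dotv a w = dotv w w - dotv (gradient f u) w by rewrite ww; ring.
  lra.
have [K KE] : exists K, K = L / 2 + (2 * gamma)^-1 by eexists.
have K0 : 0 < K by rewrite KE ltr_wpDl ?invr_gt0 ?mulr_gt0 ?divr_ge0.
apply: dotv_eq0; apply/eqP; rewrite eq_le dotv_ge0 andbT.
have := key (2 * K)^-1; rewrite -KE.
have -> : K * (2 * K)^-1 ^+ 2 * dotv w w = (2 * K)^-1 / 2 * dotv w w.
  by field; rewrite gt_eqF.
have K20 : 0 < (2 * K)^-1 by rewrite invr_gt0 mulr_gt0.
rewrite -mulrA ler_pM2l//; lra.
Qed.

End Descent.

(** * Random coordinate sampling *)

Section Sampling.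
Context {R : realType} {p : nat} {d : measure_display} {T : measurableType d}.
Variable P : probability T R.

(** By independence, the image under [X] of [P] restricted to [B] is [P B] times the law of [X];
    integrate the identity against both. *)
Lemma integral_indep (B : set T) (X : T -> R) :
  measurable B -> measurable_fun setT X -> (forall w, 0 <= X w) ->
  (forall Y, measurable Y -> P (X @^-1` Y `&` B) = (P (X @^-1` Y) * P B)%E) ->
  (\int[P]_(w in B) (X w)%:E = P B * \int[P]_w (X w)%:E)%E.
Proof.
move=> mB mX X0 indep.
pose push (m : {measure set T -> \bar R}) : {measure set R -> \bar R} :=
  measure_function_pushforward__canonical__measure_function_Measure m mX.
(* The change of variables wants an integrand that is nonnegative on all of [R]; the absolute value
   is one, and it agrees with the identity on the values of [X]. *)
pose nrm (y : R) : R := `|y|.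
pose absE (y : R) : \bar R := (nrm y)%:E.
have XE (w : T) : (X w)%:E = (absE \o X) w by rewrite /absE /nrm /= ger0_norm.
have mabs : measurable_fun setT absE.
  by apply/measurable_EFinP; exact: normr_measurable.
have absE0 y : (0 <= absE y)%E by rewrite lee_fin normr_ge0.
have PBf : P B \is a fin_num by exact: fin_num_measure.
have PB0 : 0 <= fine (P B) by rewrite fine_ge0.
rewrite (eq_integral (mu := P) (D := setT) _ _ (fun w _ => XE w)).
rewrite (eq_integral (mu := P) (D := B) _ _ (fun w _ => XE w)).
have -> : (\int[P]_(w in B) (absE \o X) w =
           \int[mrestr P mB]_w (absE \o X) w)%E.
  have mc : measurable_fun setT (absE \o X) by exact: measurableT_comp.
  rewrite -(setUv B) ge0_integral_setU//; last 4 first.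
  - exact: measurableC.
  - by rewrite setUv.
  - by move=> w _; exact: absE0.
  - by rewrite disj_set2E setICr.
  rewrite [X in (_ + X)%E](_ : _ = 0)%E ?adde0; last first.
    rewrite (eq_measure_integral mzero) ?integral_measure_zero// => A mA AB.
    rewrite /= /mrestr /mzero /= (_ : A `&` B = set0) ?measure0//.
    by apply/seteqP; split=> [w [/AB]|].
  apply: eq_measure_integral => A mA AB.
  by rewrite /= /mrestr setIidl.
transitivity (\int[push (mrestr P mB)]_y absE y)%E.
  by rewrite ge0_integral_pushforward// => y _; exact: absE0.
transitivity (\int[mscale (NngNum PB0) (push P)]_y absE y)%E.
  apply: eq_measure_integral => A mA _.
  by rewrite /= /pushforward /mrestr /mscale/= indep// fineK// muleC.
rewrite ge0_integral_mscale//=.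
rewrite fineK//; congr (_ * _)%E.
by rewrite ge0_integral_pushforward// => y _; exact: absE0.
Qed.

(** The [c]-subsets that avoid [j] are those of the complement of [j], and
    [p * 'C(p.-1, c) = (p - c) * 'C(p, c)]. *)
Lemma card_draws_mem (c : nat) (j : 'I_p) :
  (p * #|[pred S : {set 'I_p} | (j \in S) && (#|S| == c)]| = c * 'C(p, c))%N.
Proof.
set N := #|_|.
have E : ('C(p, c) = N + 'C(p.-1, c))%N.
  rewrite -[X in 'C(X, c)]card_ord -card_draws cardsE.
  have -> : p.-1 = #|finset.setC (finset.set1 j)| by rewrite cardsC1 card_ord.
  rewrite -cards_draws cardsE /N -(cardID [pred S : {set 'I_p} | j \in S]); congr (_ + _)%N.
    by apply: eq_card => S; rewrite !inE andbC.
  apply: eq_card => S; rewrite !inE.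
  change ((j \notin S) && (#|S| == c) = (S \subset finset.setC (finset.set1 j)) && (#|S| == c)).
  by rewrite finset.subsetC finset.sub1set finset.in_setC.
have [cp|pc] := leqP c p.
  have := mul_bin_down p c; move: E; move: 'C(p.-1, c) 'C(p, c) => B A E h.
  have : (p * A = p * N + p * B)%N by rewrite E mulnDr.
  by rewrite h -{1}(subnK cp) mulnDl addnC => /addIn.
by move: E; rewrite bin_small// muln0 => /esym/eqP; rewrite addn_eq0 => /andP[/eqP-> _]; rewrite muln0.
Qed.

(* The random set C selects each coordinate with probability c / p. *)
Lemma integral_sampled_sum (c : nat) (C : T -> {set 'I_p}) (X : 'I_p -> T -> R) :
  (0 < p)%N -> (c <= p)%N ->
  (forall j, measurable_fun setT (X j)) -> (forall j w, 0 <= X j w) ->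
  (forall S, measurable (C @^-1` [set S])) -> (forall w, #|C w| = c) ->
  (forall S : {set 'I_p}, #|S| = c -> P (C @^-1` [set S]) = (('C(p, c)%:R)^-1)%:E) ->
  (forall (S : {set 'I_p}) (Y : set R), measurable Y ->
    P ((fun w => \sum_(j in S) X j w) @^-1` Y `&` C @^-1` [set S]) =
    (P ((fun w => (\sum_(j in S) X j w)%R) @^-1` Y) * P (C @^-1` [set S]))%E) ->
  (\int[P]_w (\sum_(j in C w) X j w)%:E =
   (c%:R / p%:R)%:E * \int[P]_w (\sum_j X j w)%:E)%E.
Proof.
move=> p0 cp mX X0 mC cardC unifC indepC.
pose XS (S : {set 'I_p}) w : R := \sum_(j in S) X j w.
have XS0 S w : 0 <= XS S w by apply: sumr_ge0.
have mXS S : measurable_fun setT (XS S).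
  rewrite (_ : XS S = fun w => \sum_(j <- enum S) X j w); first exact: measurable_sum.
  by apply/funext => w; rewrite big_enum.
pose a j := (\int[P]_w (X j w)%:E)%E.
have a0 j : (0 <= a j)%E by apply: integral_ge0 => w _; rewrite lee_fin.
have intXS S : (\int[P]_w (XS S w)%:E = \sum_(j in S) a j)%E.
  rewrite (eq_integral (fun w => \sum_(j <- enum S) (X j w)%:E)%E); last first.
    by move=> w _; rewrite /XS sumEFin big_enum.
  rewrite ge0_integral_sum ?big_enum//.
  - by move=> j; apply/measurable_EFinP.
  - by move=> j w _; rewrite lee_fin.
pose k (S : {set 'I_p}) : R := if #|S| == c then ('C(p, c)%:R)^-1 else 0.
have kE S : P (C @^-1` [set S]) = (k S)%:E.
  rewrite /k; case: eqP => [/unifC//|Sc].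
  rewrite [X in P X](_ : _ = set0) ?measure0//.
  by apply/seteqP; split=> [w /= CS|//]; case: Sc; rewrite -CS cardC.
have k0 S : 0 <= k S by rewrite /k; case: ifP => // _; rewrite invr_ge0.
(* Split according to the value of [C]: for each outcome exactly one indicator is nonzero. *)
transitivity (\int[P]_w \sum_(S : {set 'I_p})
    ((fun w => (XS S w)%:E) \_ (C @^-1` [set S])) w)%E.
  apply: eq_integral => w _; rewrite (bigD1 (C w))//= [X in (_ + X)%E]big1 ?adde0.
  - by rewrite patchE mem_set//=.
  - by move=> S SC; rewrite patchE memNset//= => CS; rewrite CS eqxx in SC.
rewrite ge0_integral_sum//; last 2 first.
- by move=> S; apply/(measurable_restrictT _ (mC S)); apply/measurable_EFinP; exact: measurable_funTS.
- by move=> S w _; rewrite patchE; case: ifP => // _; rewrite lee_fin.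
transitivity (\sum_(S : {set 'I_p}) \sum_(j in S) (k S)%:E * a j)%E.
  apply: eq_bigr => S _; rewrite -integral_mkcond integral_indep//; last exact: indepC.
  by rewrite kE intXS ge0_sume_distrr.
rewrite (exchange_big_dep xpredT)//=.
have -> : (\int[P]_w (\sum_j X j w)%:E = \sum_j a j)%E.
  transitivity (\int[P]_w (XS finset.setT w)%:E)%E.
    by apply: eq_integral => w _; congr (_%:E); apply: eq_bigl => j; rewrite finset.in_setT.
  by rewrite intXS; apply: eq_bigl => j; rewrite finset.in_setT.
rewrite ge0_sume_distrr//; apply: eq_bigr => j _.
rewrite -ge0_sume_distrl; last by move=> S _; rewrite lee_fin.
congr (_ * _)%E; rewrite sumEFin; congr (_%:E).
rewrite -big_mkcondr sumr_const -[LHS]mulr_natl.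
have := card_draws_mem c j => /(congr1 (fun n => n%:R : R)); rewrite !natrM => h.
have C0 : ('C(p, c)%:R : R) != 0 by rewrite pnatr_eq0 -lt0n bin_gt0.
have P0 : (p%:R : R) != 0 by rewrite pnatr_eq0 -lt0n.
by apply: (mulfI P0); rewrite mulrA h; field; rewrite C0 P0.
Qed.

End Sampling.

Section DRSSampling.
Context {R : realType} {p : nat} {d : measure_display} {T : measurableType d}.
Variables (P : probability T R) (f : 'rV[R]_p -> R) (g : 'rV[R]_p -> \bar R).
Variables (gamma : R) (c : nat) (s0 : 'rV[R]_p).
Variables (u v s : nat -> T -> 'rV[R]_p) (C : nat -> T -> {set 'I_p}).
Hypothesis drs : rand_DRS P f g gamma c s0 u v s C.

(** Stated over an arbitrary measurable space so that it serves both for [T] and for [T] equipped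
    with the sigma-algebra [past]. *)
Lemma measurable_residual (d' : measure_display) (T' : measurableType d')
    (a b : T' -> 'rV[R]_p) (S : {set 'I_p}) :
  (forall j, measurable_fun setT (fun w => a w 0 j)) ->
  (forall j, measurable_fun setT (fun w => b w 0 j)) ->
  measurable_fun setT (fun w => \sum_(j in S) (b w - a w) 0 j ^+ 2).
Proof.
move=> ma mb.
rewrite (_ : (fun _ => _) = fun w => \sum_(j <- enum S) (b w 0 j - a w 0 j) ^+ 2).
  by apply: measurable_sum => j; apply: measurable_funX; exact: measurable_funB.
by apply/funext => w; rewrite big_enum; apply: eq_bigr => j _; rewrite !mxE.
Qed.

(** Makes the independence of [C] from the past applicable to the residual: the entries of the
    current [u] and [v] generate part of [past]. *)
Lemma past_residual k (S : {set 'I_p}) (Y : set R) : measurable Y ->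
  past u v C k.+1
    ((fun w => \sum_(j in S) (v k.+1 w - u k.+1 w) 0 j ^+ 2) @^-1` Y).
Proof.
move=> mY; rewrite /past; set G := (X in <<s X >>).
rewrite -[X in <<s G >> X]setTI.
have gen (a : T -> R) : (forall B, measurable B -> G (a @^-1` B)) ->
    @measurable_fun _ _ (g_sigma_algebraType G) R setT a.
  by move=> Ga _ B mB; rewrite setTI; apply: sub_sigma_algebra; exact: Ga.
apply: (@measurable_residual _ (g_sigma_algebraType G) (u k.+1) (v k.+1) S) => // j;
  apply: gen => B mB; left; exists k.+1; rewrite /= ?ltnS//; exists j => //.
- by left; exists B.
- by right; exists B.
Qed.

Lemma integral_updated_residual k : (0 < p)%N -> (c <= p)%N ->
  (\int[P]_w (\sum_(j in C k.+1 w) (v k.+1 w - u k.+1 w) 0 j ^+ 2)%:E =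
   (c%:R / p%:R)%:E *
     \int[P]_w (\sum_j (v k.+1 w - u k.+1 w) 0 j ^+ 2)%:E)%E.
Proof.
move=> p0 cp.
apply: (integral_sampled_sum (C := C k.+1)
  (X := fun j w => (v k.+1 w - u k.+1 w) 0 j ^+ 2)) => //.
- move=> j; rewrite (_ : (fun _ => _) = fun w => (v k.+1 w 0 j - u k.+1 w 0 j) ^+ 2).
    by apply: measurable_funX; apply: measurable_funB; [exact: drs_meas_v drs _ _|exact: drs_meas_u drs _ _].
  by apply/funext => w; rewrite !mxE.
- by move=> j w; exact: sqr_ge0.
- exact: drs_meas_C drs k.
- exact: drs_card_C drs k.
- exact: drs_unif_C drs k.
- by move=> S Y mY; apply: (drs_indep_C drs); exact: past_residual.
Qed.

End DRSSampling.

(** * Deterministic convergence and subdifferentials *)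

Section Deterministic.
Context {R : realType}.

(** With [x = gamma L] and [y = gamma l], dropping two nonnegative terms leaves
    [x^2 + 2 x + 5 y / 2 < 1 / 2]. The last conclusion says that the gain on updated coordinates is
    at least the loss on frozen ones. *)
Lemma step_size_bounds (gamma L l q : R) : 0 < gamma -> 0 <= L -> 0 <= L + l ->
  0 <= q ->
  (1 + gamma * L) ^+ 2 + gamma * L ^+ 2 + 5 * gamma * l / 2
      + (1 + gamma) * (1 + gamma * l) ^+ 2 * q - 3 / 2 < 0 ->
  [/\ gamma * L < 1, 0 < 1 + (gamma * L - gamma * l) / 2,
    0 < 1 / 2 - gamma * l / 2 - (gamma * L) ^+ 2 - (gamma * L + gamma * l) / 2 &
    (gamma * L + gamma * l) / 2 / (1 + (gamma * L - gamma * l) / 2) ^+ 2 <=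
    (1 / 2 - gamma * l / 2 - (gamma * L) ^+ 2 - (gamma * L + gamma * l) / 2)
     / (1 + gamma * L) ^+ 2].
Proof.
move=> g0 L0 Ll q0 cond.
have h1 : 0 <= gamma * L ^+ 2 by rewrite mulr_ge0 ?sqr_ge0// ltW.
have h2 : 0 <= (1 + gamma) * (1 + gamma * l) ^+ 2 * q.
  apply: mulr_ge0 => //; apply: mulr_ge0; rewrite ?sqr_ge0//; lra.
have x0 : 0 <= gamma * L by rewrite mulr_ge0// ltW.
have xy : 0 <= gamma * L + gamma * l by rewrite -mulrDr mulr_ge0// ltW.
have {cond h1 h2} cond : (1 + gamma * L) ^+ 2 + 5 * (gamma * l) / 2 < 3 / 2.
  by move: cond h1 h2; rewrite !mulrA; lra.
move: (gamma * L) (gamma * l) x0 xy cond => x y x0 xy cond.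
have x2 : 0 <= x ^+ 2 by exact: sqr_ge0.
have cond' : x ^+ 2 + 2 * x + 5 * y / 2 < 1 / 2.
  by lra.
have x1 : x < 1.
  rewrite ltNge; apply/negP => x1.
  (* As [y >= - x], the condition gives [x^2 - x / 2 - 1 / 2 < 0], whose left side factors this
     way. *)
  have : 0 <= (x - 1) * (x + 1 / 2) by apply: mulr_ge0; lra.
  by lra.
have m0 : 0 < 1 + (x - y) / 2 by lra.
split=> //; first by lra.
rewrite ler_pdivrMr ?exprn_gt0// mulrAC ler_pdivlMr ?exprn_gt0//; last by lra.
set S := (x + y) / 2; set m := 1 + (x - y) / 2.
(* [cond'] is precisely the statement that [3 S] is below the factor in front of [m ^+ 2]; it then
   suffices that [(1 + x)^2 <= 3 m^2], which follows from [3 (1 + x) <= 5 m]. *)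
apply: (@le_trans _ _ (3 * S * m ^+ 2)); last first.
  by apply: ler_wpM2r; [exact: sqr_ge0|rewrite /S; lra].
have -> : 3 * S * m ^+ 2 = S * (3 * m ^+ 2) by ring.
apply: ler_wpM2l; first by rewrite /S; lra.
have hm : 3 * (1 + x) <= 5 * m by rewrite /m; lra.
have : (3 * (1 + x)) ^+ 2 <= (5 * m) ^+ 2 by rewrite ler_pXn2r ?nnegrE// ?mulr_ge0//; lra.
have m20 : 0 <= m ^+ 2 by exact: sqr_ge0.
rewrite !exprMn; lra.
Qed.

(** Subtracting the partial sums of [b] from [E] leaves a nonincreasing sequence bounded below by
    [m - M]. *)
Lemma almost_decreasing_cvg (E b : nat -> R) (m M : R) :
  (forall k, m <= E k) -> (forall k, 0 <= b k) ->
  (forall k, E k.+1 <= E k + b k) ->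
  (forall n, \sum_(0 <= i < n) b i <= M) ->
  cvgn E.
Proof.
move=> Em b0 Eb bM.
have cb : cvgn (series b).
  apply: nondecreasing_is_cvgn.
    by apply/nondecreasing_seqP => n; rewrite /series/= big_nat_recr//= lerDl.
  by exists M => _ [n _ <-]; exact: bM.
have ce : cvgn (fun k => E k - series b k).
  apply: nonincreasing_is_cvgn.
    apply/nonincreasing_seqP => n; rewrite /series/= big_nat_recr//=.
    by have := Eb n; lra.
  by exists (m - M) => _ [n _ <-]; rewrite lerB//; exact: bM.
rewrite (_ : E = fun k => (E k - series b k) + series b k); first exact: is_cvgD.
by apply/funext => k; rewrite subrK.
Qed.

End Deterministic.

Section Stationarity.
Context {R : realType} {p : nat}.
Implicit Types (f : 'rV[R]_p -> R) (g h : 'rV[R]_p -> \bar R).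
Implicit Types (x y z w : 'rV[R]_p).

(** The minorant bounds the difference quotient below by [- K |y - x|], so its infimum is at least
    [- e] on the punctured neighbourhood [V]. *)
Lemma frechet_of_quadratic_minorant h x w (K : R) : 0 <= K ->
  h x \is a fin_num ->
  (forall y, (h x + (dotv w (y - x) - K * dotv (y - x) (y - x))%:E <= h y)%E) ->
  frechet_subdiff h x w.
Proof.
move=> K0 hx hy; split=> //; rewrite limf_einfE.
apply/lee_addgt0Pr => e e0.
pose V := [set y | y != x /\ K * enorm (y - x) <= e].
apply: (@le_trans _ _ (ereal_inf [set ((h y - h x - (dotv w (y - x))%:E) *
    ((enorm (y - x))^-1)%:E)%E | y in V] + e%:E)%E); last first.
  rewrite leeD2r//; apply: ereal_sup_ubound; exists V => //.
  rewrite /V /dnbhs /within /=.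
  have c : K * enorm (y - x) @[y --> nbhs (x : 'rV[R]_p)] --> K * enorm (x - x).
    apply: cvgMr.
    have cx : y - x @[y --> nbhs (x : 'rV[R]_p)] --> x - x by apply: cvgB; [exact: cvg_id|exact: cvg_cst].
    have c2 : dotv (y - x) (y - x) @[y --> nbhs (x : 'rV[R]_p)] --> dotv (x - x) (x - x) by exact: (cvg_dotv cx cx).
    exact: (@cvg_comp _ _ _ (fun y => dotv (y - x) (y - x)) (@Num.sqrt R) _ _ _ c2 (@sqrt_continuous R _)).
  have : \forall y \near x, K * enorm (y - x) < e.
    apply: (cvgr_lt _ c).
    by rewrite subrr /enorm dotv0r sqrtr0 mulr0.
  by apply: filterS => y Ky yx; split => //; exact: ltW.
rewrite -leeBlDr// sub0e; apply: le_ereal_inf_tmp => _ [y [yx Ky] <-].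
have d0 : 0 < enorm (y - x) by apply: enorm_gt0; rewrite subr_eq0.
have := hy y; move: hx; case: (h x) => // a _; case: (h y) => [b| |] //; last first.
  by move=> _; rewrite /= mulyr gtr0_sg ?invr_gt0// mul1e leey.
rewrite -?(EFinN, EFinD, EFinM) !lee_fin => hab.
rewrite ler_pdivlMr//.
have : K * enorm (y - x) * enorm (y - x) <= e * enorm (y - x) by rewrite ler_pM2r.
by rewrite -mulrA -expr2 sqr_enorm; lra.
Qed.

(** The proximal inequality is a quadratic minorant of [g] with slope [(z - x) / gamma]; add the one
    of [f]. The absolute value of [l] keeps the curvature constant nonnegative. *)
Lemma prox_subgradient f g (gamma l : R) x z : 0 < gamma ->
  (forall x y, f x + dotv (gradient f x) (y - x) - l / 2 * dotv (y - x) (y - x) <= f y) ->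
  g x \is a fin_num -> prox gamma g z x ->
  frechet_subdiff (fun y => (f y)%:E + g y)%E x (gradient f x + gamma^-1 *: (z - x)).
Proof.
move=> g0 lb gx px.
apply: (@frechet_of_quadratic_minorant _ _ _ (`|l| / 2 + (2 * gamma)^-1)).
- by rewrite addr_ge0// ?divr_ge0// invr_ge0 mulr_ge0// ltW.
- by rewrite fin_numD gx.
move=> y; have := px y; have := lb x y; move: gx.
rewrite !sqr_enorm; case: (g x) => // a _; case: (g y) => [b| |] //; last by move=> _ _; rewrite addey// leey.
rewrite -!EFinD !lee_fin.
have -> : y - z = (y - x) - (z - x) by rewrite opprB addrA subrK.
have -> : dotv (x - z) (x - z) = dotv (z - x) (z - x) by rewrite -opprB dotvNl dotvNr opprK.
move: (y - x) (z - x) => D e h1.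
have -> : (2 * gamma)^-1 * dotv (D - e) (D - e) = (2 * gamma)^-1 * dotv D D
   - gamma^-1 * dotv e D + (2 * gamma)^-1 * dotv e e.
  by rewrite !dotvE (dotvC D e); field; rewrite gt_eqF.
rewrite dotvDl dotvZl => h2.
have h3 : l * dotv D D <= `|l| * dotv D D by rewrite ler_wpM2r ?dotv_ge0// ler_norm.
lra.
Qed.

(** [phi] need not be increasing: [n < phi n] already makes it tend to infinity, and also makes
    [phi n] positive, so that its predecessor can be used as an index. *)
Lemma cluster_subseq (a : nat -> 'rV[R]_p) x : cluster (a k @[k --> \oo]) x ->
  exists2 phi : nat -> nat, (forall n, (n < phi n)%N) & a (phi n) @[n --> \oo] --> x.
Proof.
move=> cx.
have H n : exists k, (n < k)%N /\ `|x - a k| < n.+1%:R^-1.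
  have [| |_ [[k /= nk <-]] xk] := cx [set a k | k in [set k | (n < k)%N]] (ball x n.+1%:R^-1).
  - by exists n.+1 => // k /= nk; exists k.
  - by apply: nbhsx_ballx; rewrite invr_gt0.
  - by exists k; split => //; move: xk; rewrite -ball_normE.
have [phi hphi] := choice H; exists phi; first by move=> n; exact: (hphi n).1.
apply/cvgrPdist_lt => e e0; near=> n.
apply: lt_trans (hphi n).2 _.
near: n; exact: near_infty_natSinv_lt (PosNum e0).
Unshelve. all: by end_near. Qed.

Lemma cluster_sub_vanishing (a b : nat -> 'rV[R]_p) :
  b k - a k @[k --> \oo] --> (0 : 'rV[R]_p) ->
  cluster (a k @[k --> \oo]) `<=` cluster (b k @[k --> \oo]).
Proof.
move=> ab x cx A B [N _ NA] /nbhs_ballP[e e0 eB].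
have e20 : 0 < e / 2 by rewrite divr_gt0.
move/cvgr0Pnorm_lt : ab => /(_ _ e20)[N' _ N'ab].
have [| |_ [[k /= Nk <-] xk]] := cx [set a k | k in [set k | (maxn N N' <= k)%N]] (ball x (e / 2)).
- by exists (maxn N N') => // k /= nk; exists k.
- by apply: nbhsx_ballx; rewrite ?divr_gt0.
exists (b k); split; first by apply: NA; rewrite /= (leq_trans _ Nk)// leq_maxl.
apply: eB; have : `|b k - a k| < e / 2.
  by apply: N'ab; rewrite /= (leq_trans _ Nk)// leq_maxr.
move: xk; rewrite -!ball_normE /= => h1 h2.
have -> : x - b k = (x - a k) - (b k - a k) by rewrite opprB addrA subrK.
by rewrite (le_lt_trans (ler_normB _ _))// (splitr e) ltrD.
Qed.

End Stationarity.

(** * The splitting iteration along one path *)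

Section Pathwise.
Context {R : realType} {p : nat}.
Variables (f : 'rV[R]_p -> R) (g : 'rV[R]_p -> \bar R) (gamma L l m : R).
Hypotheses (gamma_gt0 : 0 < gamma) (L_ge0 : 0 <= L) (Ll_ge0 : 0 <= L + l).
Hypotheses (f_smooth : L_smooth L f) (g_proper : proper_efun g).
Hypothesis f_lower : forall x y,
  f x + dotv (gradient f x) (y - x) - l / 2 * dotv (y - x) (y - x) <= f y.
Hypothesis g_lsc : lower_semicontinuous g.
Hypothesis phi_ge : forall x, (m%:E <= (f x)%:E + g x)%E.

Let S0 := (gamma * L + gamma * l) / 2.
Let mu := 1 + (gamma * L - gamma * l) / 2.
Let B := 1 / 2 - gamma * l / 2 - (gamma * L) ^+ 2 - S0.
Hypotheses (gammaL_lt1 : gamma * L < 1) (mu_gt0 : 0 < mu) (B_gt0 : 0 < B).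

(** Shifted indices: [U k], [V k], [C k] stand for the iterates numbered [k.+1], but [S k] for the
    one numbered [k]. Hence the Lagrangian of a step involves [S k.+1]. *)
Variables (U V S : nat -> 'rV[R]_p) (C : nat -> {set 'I_p}).
Hypothesis proxU : forall k, prox gamma (EFin \o f) (S k) (U k).
Hypothesis proxV : forall k, prox gamma g (2 *: U k - S k) (V k).
Hypothesis updS : forall k,
  S k.+1 = S k + \sum_(j in C k) (V k - U k) 0 j *: delta_mx 0 j.

Let rho k := \sum_(j in C k) (V k - U k) 0 j ^+ 2.
Let tot k := \sum_j (V k - U k) 0 j ^+ 2.
Let En k := envelope f (fine (g (V k))) gamma (U k) (V k).

Lemma prox_fin_num x z : prox gamma g z x -> g x \is a fin_num.
Proof.
have [gNy [x0 gx0]] := g_proper.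
move=> /(_ x0); have := gNy x; move: gx0.
by case: (g x0) => // b _; case: (g x).
Qed.

Let gV k : g (V k) = (fine (g (V k)))%:E.
Proof. by rewrite fineK//; exact: prox_fin_num (proxV k). Qed.

Let SE k : S k = U k + gamma *: gradient f (U k).
Proof. exact: prox_smooth_gradient f_smooth (proxU k). Qed.

Let totE k : tot k = dotv (V k - U k) (V k - U k).
Proof. by apply: eq_bigr => j _; rewrite expr2. Qed.

Lemma updated_part_entry (r : 'rV[R]_p) (A : {set 'I_p}) i :
  (\sum_(j in A) r 0 j *: (delta_mx 0 j : 'rV[R]_p)) 0 i = if i \in A then r 0 i else 0.
Proof.
rewrite summxE; case: ifP => iA.
  rewrite (bigD1 i)//= big1 ?addr0; last first.
    by move=> j /andP[_ ji]; rewrite !mxE eqxx /= (negbTE (_ : i != j)) ?mulr0// eq_sym.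
  by rewrite !mxE !eqxx mulr1.
rewrite big1// => j jA; rewrite !mxE eqxx /=.
by case: eqP => [ij|_]; [rewrite ij jA in iA|rewrite mulr0].
Qed.

Lemma updated_part_dotv (r : 'rV[R]_p) (A : {set 'I_p}) :
  let rC := \sum_(j in A) r 0 j *: (delta_mx 0 j : 'rV[R]_p) in
  [/\ dotv rC rC = \sum_(j in A) r 0 j ^+ 2, dotv rC r = \sum_(j in A) r 0 j ^+ 2 &
      dotv rC (r - rC) = 0].
Proof.
move=> rC.
have e1 : dotv rC rC = \sum_(j in A) r 0 j ^+ 2.
  rewrite /dotv [RHS]big_mkcond; apply: eq_bigr => j _.
  by rewrite updated_part_entry; case: ifP; rewrite ?mulr0// expr2.
have e2 : dotv rC r = \sum_(j in A) r 0 j ^+ 2.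
  rewrite /dotv [RHS]big_mkcond; apply: eq_bigr => j _.
  by rewrite updated_part_entry; case: ifP; rewrite ?mul0r// expr2.
by split => //; rewrite dotvDr dotvNr e1 e2 subrr.
Qed.

Lemma energy_step k :
  gamma * (En k.+1 - En k) <=
  - (B / (1 + gamma * L) ^+ 2) * rho k + S0 / mu ^+ 2 * (tot k - rho k).
Proof.
set r := V k - U k.
set rC := \sum_(j in C k) r 0 j *: (delta_mx 0 j : 'rV[R]_p).
have [e1 e2 e3] := updated_part_dotv r (C k); rewrite -/rC in e1 e2 e3.
have -> : rho k = dotv rC rC by rewrite e1.
have -> : tot k - dotv rC rC = dotv (r - rC) (r - rC).
  rewrite totE -/r [in RHS]dotvDl dotvNl e3 dotvDr dotvNr (dotvC r rC) e2 e1; ring.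
apply: (envelope_decrease (rC := rC) (w := r - rC) gamma_gt0 L_ge0 f_lower f_smooth Ll_ge0 mu_gt0 (ltW B_gt0)
  (SE k) (SE k.+1)) => //.
- have := proxV k.+1 (V k); rewrite gV (gV k) -!EFinD lee_fin.
  by rewrite addrC.
- by rewrite subrKC.
Qed.

Lemma energy_lb k : m + (2 * gamma)^-1 * (1 - gamma * L) * tot k <= En k.
Proof.
rewrite totE; apply: le_trans (envelope_lower_bound _ _ _ gamma_gt0 L_ge0 f_smooth).
by rewrite lerD2r -lee_fin EFinD -gV; exact: phi_ge.
Qed.

Let rho_ge0 k : 0 <= rho k.
Proof. by apply: sumr_ge0 => j _; exact: sqr_ge0. Qed.

Let tot_ge0 k : 0 <= tot k.
Proof. by apply: sumr_ge0 => j _; exact: sqr_ge0. Qed.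

Let rho_le_tot k : rho k <= tot k.
Proof. by rewrite /rho big_mkcond; apply: ler_sum => j _; case: ifP => // _; exact: sqr_ge0. Qed.

Let S0_ge0 : 0 <= S0.
Proof. by rewrite divr_ge0// -mulrDr mulr_ge0// ltW. Qed.

Lemma m_le_energy k : m <= En k.
Proof.
apply: le_trans (energy_lb k); rewrite lerDl mulr_ge0// mulr_ge0//.
  by rewrite invr_ge0 mulr_ge0// ltW.
by rewrite subr_ge0 ltW.
Qed.

Lemma energy_step_le k : En k.+1 <= En k + S0 / mu ^+ 2 / gamma * tot k.
Proof.
have h : gamma * (En k.+1 - En k) <= S0 / mu ^+ 2 * tot k.
  apply: le_trans (energy_step k) _.
  have : 0 <= B / (1 + gamma * L) ^+ 2 * rho k.
    by rewrite mulr_ge0// divr_ge0 ?sqr_ge0// ltW.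
  have : 0 <= S0 / mu ^+ 2 * rho k.
    by rewrite mulr_ge0// divr_ge0 ?sqr_ge0// ltW.
  lra.
rewrite -lerBlDl mulrAC ler_pdivlMr//; by rewrite mulrC.
Qed.

(* Telescoped form of the descent, kept free of E_k so that no measurability of
   g is needed when expectations are taken. *)
Lemma energy_telescope n :
  (B / (1 + gamma * L) ^+ 2 + S0 / mu ^+ 2) * \sum_(0 <= k < n) rho k <=
  gamma * (En 0 - m) + S0 / mu ^+ 2 * \sum_(0 <= k < n) tot k.
Proof.
have : (B / (1 + gamma * L) ^+ 2 + S0 / mu ^+ 2) * \sum_(0 <= k < n) rho k <=
  gamma * (En 0 - En n) + S0 / mu ^+ 2 * \sum_(0 <= k < n) tot k.
  elim: n => [|n IH]; first by rewrite !big_geq// !mulr0 subrr mulr0 addr0.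
  rewrite !big_nat_recr//=; have := energy_step n; lra.
have := m_le_energy n; rewrite -(ler_pM2l gamma_gt0); lra.
Qed.

(** [S k.+1 - U k] is [gamma *: gradient f (U k)] plus the updated part of the residual, whose inner
    product with the whole residual is [rho k]. *)
Lemma Lagr_energy k :
  Lagr f g gamma (U k) (V k) (S k.+1) =
  (En k - gamma^-1 * (tot k - rho k))%:E.
Proof.
rewrite /Lagr gV -?(EFinN, EFinD); congr (_%:E).
have [e1 e2 _] := updated_part_dotv (V k - U k) (C k).
rewrite updS SE sqr_enorm /En /envelope totE.
have -> : U k + gamma *: gradient f (U k) +
   \sum_(j in C k) (V k - U k) 0 j *: delta_mx 0 j - U k =
   gamma *: gradient f (U k) + \sum_(j in C k) (V k - U k) 0 j *: delta_mx 0 j.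
  by rewrite -!addrA addrC -!addrA addNr addr0.
rewrite (dotvDl (gamma *: _)) (dotvZl gamma) e2 -/(rho k).
by field; rewrite gt_eqF.
Qed.

Variable M : R.
Hypothesis tot_sum : forall n, \sum_(0 <= k < n) tot k <= M.

Lemma tot_cvg0 : tot k @[k --> \oo] --> 0.
Proof.
apply: cvg_series_cvg_0; apply: nondecreasing_is_cvgn.
  by apply/nondecreasing_seqP => n; rewrite /series/= big_nat_recr//= lerDl.
by exists M => _ [n _ <-]; exact: tot_sum.
Qed.

Lemma Lagr_cvg : exists Lstar : R,
  Lagr f g gamma (U k) (V k) (S k.+1) @[k --> \oo] --> Lstar%:E.
Proof.
have cE : cvgn En.
  pose K := S0 / mu ^+ 2 / gamma.
  have K0 : 0 <= K.
    by apply: divr_ge0; [apply: divr_ge0 => //; exact: sqr_ge0|exact: ltW].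
  apply: (@almost_decreasing_cvg _ En (fun k => K * tot k) m (K * M)).
  - exact: m_le_energy.
  - by move=> k; rewrite mulr_ge0.
  - exact: energy_step_le.
  - by move=> n; rewrite -mulr_sumr ler_wpM2l.
have ctr : gamma^-1 * (tot k - rho k) @[k --> \oo] --> 0.
  rewrite -[X in _ --> X](mulr0 gamma^-1); apply: cvgMr.
  apply: (@squeeze_cvgr _ _ _ _ (fun=> 0) tot); last 2 first.
  - exact: cvg_cst.
  - exact: tot_cvg0.
  - by near=> k; rewrite subr_ge0 rho_le_tot gerBl rho_ge0.
exists (limn En - 0); under eq_fun do rewrite Lagr_energy.
by apply: cvg_EFin; [exact: nearW|exact: cvgB].
Unshelve. all: by end_near. Qed.

Lemma residual_cvg0 : V k - U k @[k --> \oo] --> (0 : 'rV[R]_p).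
Proof.
apply: cvg_enorm0; under eq_fun do rewrite sqr_enorm -totE.
exact: tot_cvg0.
Qed.

Lemma gradient_cvg (xn : nat -> 'rV[R]_p) x : xn n @[n --> \oo] --> x ->
  gradient f (xn n) @[n --> \oo] --> gradient f x.
Proof.
move=> xnx.
have d0 : L ^+ 2 * dotv (xn n - x) (xn n - x) @[n --> \oo] --> 0.
  rewrite -[X in _ --> X](mulr0 (L ^+ 2)); apply: cvgMr.
  have c : xn n - x @[n --> \oo] --> x - x by apply: cvgB; [exact: xnx|exact: cvg_cst].
  have : dotv (xn n - x) (xn n - x) @[n --> \oo] --> dotv (x - x) (x - x) by exact: (cvg_dotv c c).
  by rewrite subrr dotv0r.
apply/subr_cvg0; apply: cvg_enorm0.
apply: (squeeze_cvgr (f := fun=> 0) (h := fun n => L ^+ 2 * dotv (xn n - x) (xn n - x))).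
- by near=> n; rewrite sqr_ge0 sqr_enorm (L_smooth_sqr _ _ f_smooth).
- exact: cvg_cst.
- exact: d0.
Unshelve. all: by end_near. Qed.

(** The points [V (sub n)] also tend to [x] and carry explicit subgradients that tend to 0. The
    delicate part is [g (V (sub n)) --> g x]: proximal optimality bounds it from above, lower
    semicontinuity from below. *)
Lemma subseq_limit_stationary (sub : nat -> nat) x :
  (forall n, (n <= sub n)%N) -> U (sub n) @[n --> \oo] --> x ->
  stationary (fun y => (f y)%:E + g y)%E x.
Proof.
move=> sub_ge Ux.
have subc : sub n @[n --> \oo] --> \oo.
  apply/cvgnyPge => N; near=> n; rewrite (leq_trans _ (sub_ge n))//.
  by near: n; exact: nbhs_infty_ge.
have rc : V (sub n) - U (sub n) @[n --> \oo] --> (0 : 'rV[R]_p).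
  exact: (cvg_comp _ _ subc residual_cvg0).
have Vx : V (sub n) @[n --> \oo] --> x.
  rewrite (_ : (fun n => V (sub n)) = fun n => U (sub n) + (V (sub n) - U (sub n))); last by apply/funext => n; rewrite subrKC.
  rewrite -[x]addr0.
  exact: cvgD.
pose z k := 2 *: U k - S k.
have zE k : z k = U k - gamma *: gradient f (U k).
  by rewrite /z SE; apply/rowP => j; rewrite !mxE; ring.
pose zx := x - gamma *: gradient f x.
have zc : z (sub n) @[n --> \oo] --> zx.
  under eq_fun do rewrite zE.
  apply: cvgB => //; apply: cvgZl_tmp; exact: gradient_cvg.
pose qz y n := (2 * gamma)^-1 * dotv (y n - z (sub n)) (y n - z (sub n)).
have qc (y : nat -> 'rV[R]_p) (yx : 'rV[R]_p) : y n @[n --> \oo] --> yx ->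
    qz y n @[n --> \oo] --> (2 * gamma)^-1 * dotv (yx - zx) (yx - zx).
  move=> yc; apply: cvgMr.
  have c : y n - z (sub n) @[n --> \oo] --> yx - zx by exact: cvgB.
  exact: (cvg_dotv c c).
have prox_le (y : 'rV[R]_p) (gy : R) n : g y = gy%:E ->
    fine (g (V (sub n))) <= gy + qz (fun=> y) n - qz (fun n => V (sub n)) n.
  move=> gyE; have := proxV (sub n) y; rewrite gV gyE -!EFinD lee_fin !sqr_enorm.
  by rewrite /qz /z; lra.
have [gNy [x0 gx0]] := g_proper.
(* If [g x] were infinite, lower semicontinuity would push [g (V (sub n))] above [lb + 1], whereas
   comparison with [x0] keeps it below a sequence tending to [lb]. *)
have gx_fin : g x \is a fin_num.
  rewrite fin_numE gNy /=; apply/eqP => gxy.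
  have gx0E : g x0 = (fine (g x0))%:E by rewrite fineK.
  pose b n := fine (g x0) + qz (fun=> x0) n - qz (fun n => V (sub n)) n.
  pose lb := fine (g x0) + (2 * gamma)^-1 * dotv (x0 - zx) (x0 - zx)
    - (2 * gamma)^-1 * dotv (x - zx) (x - zx).
  have bc : b n @[n --> \oo] --> lb.
    apply: cvgB; last exact: qc Vx.
    by apply: cvgD; [exact: cvg_cst|apply: qc; exact: cvg_cst].
  have xlt : ((lb + 1)%:E < g x)%E by rewrite gxy ltry.
  have [W Wx gW] := g_lsc xlt.
  have WV : \forall n \near \oo, W (V (sub n)) by exact: Vx.
  have bl : \forall n \near \oo, b n < lb + 1 by apply: (cvgr_lt _ bc); rewrite ltrDl.
  near \oo => n.
  have /gW : W (V (sub n)) by near: n.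
  rewrite gV lte_fin ltNge => /negP; apply.
  by apply: le_trans (prox_le _ _ n gx0E) _; apply: ltW; near: n.
have gxE : g x = (fine (g x))%:E by rewrite fineK.
have gc : fine (g (V (sub n))) @[n --> \oo] --> fine (g x).
  pose b n := fine (g x) + qz (fun=> x) n - qz (fun n => V (sub n)) n.
  have bc : b n @[n --> \oo] --> fine (g x).
    rewrite -[X in _ --> X](addrK ((2 * gamma)^-1 * dotv (x - zx) (x - zx))).
    apply: cvgB; last exact: qc Vx.
    by apply: cvgD; [exact: cvg_cst|apply: qc; exact: cvg_cst].
  apply/cvgrPdist_lt => e e0.
  have xlt : ((fine (g x) - e)%:E < g x)%E by rewrite [ltRHS]gxE lte_fin ltrBlDr ltrDl.
  have [W Wx gW] := g_lsc xlt.
  have WV : \forall n \near \oo, W (V (sub n)) by exact: Vx.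
  have bl : \forall n \near \oo, b n < fine (g x) + e by apply: (cvgr_lt _ bc); rewrite ltrDl.
  near=> n; rewrite distrC ltr_distl; apply/andP; split.
    by rewrite -lte_fin -gV; apply: gW; near: n.
  by apply: le_lt_trans (prox_le _ _ n gxE) _; near: n.
split; first by rewrite fin_numD gx_fin.
(* These are the subgradients of [prox_subgradient] at the proximal centre
   [z k = U k - gamma *: gradient f (U k)]. *)
exists (fun n => V (sub n)), (fun n => gradient f (V (sub n)) - gradient f (U (sub n)) -
  gamma^-1 *: (V (sub n) - U (sub n))); split => //.
- under eq_fun do rewrite gV -EFinD.
  rewrite gxE -EFinD; apply: cvg_EFin; first exact: nearW.
  apply: cvgD => //; apply: (cvg_comp _ _ Vx).
  exact: differentiable_continuous (f_smooth.1 x).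
- move=> n.
  have := prox_subgradient gamma_gt0 f_lower _ (proxV (sub n)).
  rewrite gV => /(_ isT).
  rewrite (_ : _ + _ *: _ = gradient f (V (sub n)) - gradient f (U (sub n)) -
    gamma^-1 *: (V (sub n) - U (sub n)))//.
  rewrite -/(z _) zE; apply/rowP => j; rewrite !mxE; field; by rewrite gt_eqF.
- have -> : (0 : 'rV[R]_p) = gradient f x - gradient f x - gamma^-1 *: 0.
    by rewrite subrr scaler0 subr0.
  apply: cvgB; first by apply: cvgB; exact: gradient_cvg.
  exact: cvgZl_tmp.
Unshelve. all: by end_near. Qed.

End Pathwise.

(** * Almost sure summability *)

Section Summability.
Context {R : realType} {d : measure_display} {T : measurableType d}.
Variable P : probability T R.

Lemma measurable_sampled_sum (p : nat) (C : T -> {set 'I_p}) (X : 'I_p -> T -> R) :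
  (forall j, measurable_fun setT (X j)) -> (forall S, measurable (C @^-1` [set S])) ->
  measurable_fun setT (fun w => \sum_(j in C w) X j w).
Proof.
move=> mX mC.
rewrite (_ : (fun _ => _) = fun w => \sum_(S <- index_enum {set 'I_p})
    ((fun w => \sum_(j <- enum S) X j w) \_ (C @^-1` [set S])) w); last first.
  apply/funext => w; rewrite (bigD1 (C w))//= [X in _ + X]big1 ?addr0.
    by rewrite patchE mem_set//= big_enum.
  by move=> S SC; rewrite patchE memNset//= => CS; rewrite CS eqxx in SC.
apply: measurable_sum => S; apply/(measurable_restrictT _ (mC S)).
by apply: measurable_funTS; exact: measurable_sum.
Qed.

(** In expectation the bound reads [(a theta - b) * sum E[tot] <= K]. The deterministic bounds [A]
    make each expectation finite, so that this subtraction is legitimate; monotone convergence then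
    makes the whole series integrable, hence almost surely finite. *)
Lemma ae_bounded_series (rho tot : nat -> T -> R) (A : nat -> R) (theta a b K : R) :
  (forall k, measurable_fun setT (rho k)) -> (forall k, measurable_fun setT (tot k)) ->
  (forall k w, 0 <= rho k w) -> (forall k w, 0 <= tot k w) ->
  (forall k w, tot k w <= A k) ->
  (forall k, \int[P]_w (rho k w)%:E = theta%:E * \int[P]_w (tot k w)%:E)%E ->
  0 <= a -> 0 <= b -> 0 <= K -> b < a * theta ->
  (forall n w, a * \sum_(0 <= k < n) rho k w <= K + b * \sum_(0 <= k < n) tot k w) ->
  {ae P, forall w, exists M, forall n, \sum_(0 <= k < n) tot k w <= M}.
Proof.
move=> mrho mtot rho0 tot0 totA irho a0 b0 K0 bat bound.
have icst (r : R) : (\int[P]_w (cst r%:E) w = r%:E)%E.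
  rewrite integral_cst// -[RHS]mule1; congr (_ * _)%E; exact: probability_setT.
have intX (X : nat -> T -> R) n : (forall k, measurable_fun setT (X k)) ->
    (forall k w, 0 <= X k w) ->
    (\int[P]_w (\sum_(0 <= k < n) X k w)%:E = \sum_(0 <= k < n) \int[P]_w (X k w)%:E)%E.
  move=> mX X0; under eq_integral do rewrite -sumEFin.
  rewrite ge0_integral_sum//.
  - by move=> k; exact/measurable_EFinP.
  - by move=> k w _; rewrite lee_fin.
have msum (X : nat -> T -> R) n : (forall k, measurable_fun setT (X k)) ->
    measurable_fun setT (fun w => \sum_(0 <= k < n) X k w).
  by move=> mX; exact: measurable_sum.
pose al k := fine (\int[P]_w (tot k w)%:E).
have alE k : (\int[P]_w (tot k w)%:E = (al k)%:E)%E.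
  rewrite fineK// ge0_fin_numE; last by apply: integral_ge0 => w _; rewrite lee_fin.
  apply: (@le_lt_trans _ _ (\int[P]_w (cst (A k)%:E) w)%E).
    apply: ge0_le_integral => //.
    - by move=> w _; rewrite lee_fin.
    - exact/measurable_EFinP.
    - by move=> w _; rewrite lee_fin.
  by rewrite icst ltry.
have al0 k : 0 <= al k.
  by rewrite -lee_fin -alE; apply: integral_ge0 => w _; rewrite lee_fin.
have sum_al n : \sum_(0 <= k < n) al k <= K / (a * theta - b).
  pose Sr w := (\sum_(0 <= k < n) rho k w)%:E; pose St w := (\sum_(0 <= k < n) tot k w)%:E.
  have Sr0 w : setT w -> (0 <= Sr w)%E by move=> _; rewrite lee_fin sumr_ge0.
  have St0 w : setT w -> (0 <= St w)%E by move=> _; rewrite lee_fin sumr_ge0.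
  have mSr : measurable_fun setT Sr by apply/measurable_EFinP; exact: msum.
  have mSt : measurable_fun setT St by apply/measurable_EFinP; exact: msum.
  have bSt0 w : setT w -> (0 <= b%:E * St w)%E by move=> ?; rewrite mule_ge0// St0.
  have aSr0 w : setT w -> (0 <= a%:E * Sr w)%E by move=> ?; rewrite mule_ge0// Sr0.
  have mbSt : measurable_fun setT (fun w => b%:E * St w)%E by exact: measurable_funeM.
  have : (\int[P]_w (a%:E * Sr w) <= \int[P]_w (cst K%:E w + b%:E * St w))%E.
    apply: ge0_le_integral => //.
    - exact: measurable_funeM.
    - exact: emeasurable_funD.
    - by move=> w _; rewrite /Sr /St -!EFinM -EFinD lee_fin.
  rewrite ge0_integralZl_EFin// ge0_integralD// icst ge0_integralZl_EFin//.
  rewrite /Sr /St.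
  rewrite !intX//.
  under eq_bigr do rewrite irho alE -EFinM.
  under [X in (_ <= _ + _ * X)%E]eq_bigr do rewrite alE.
  rewrite !sumEFin -!EFinM -EFinD lee_fin -mulr_sumr mulrA => h.
  by rewrite ler_pdivlMr ?subr_gt0// mulrBr; lra.
have itot : P.-integrable setT (fun w => \sum_(0 <= k <oo) (tot k w)%:E)%E.
  have m : measurable_fun setT (fun w => \sum_(0 <= k <oo) (tot k w)%:E)%E.
    apply: (ge0_emeasurable_sum (P := xpredT)).
    - by move=> k w _ _; rewrite lee_fin.
    - by move=> k _; exact/measurable_EFinP.
  apply/integrableP; split => //.
  rewrite (eq_integral (fun w => \sum_(0 <= k <oo) (tot k w)%:E)%E); last first.
    by move=> w _; rewrite gee0_abs// nneseries_ge0// => k _ _; rewrite lee_fin.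
  rewrite integral_nneseries//; last 2 first.
  - by move=> k; exact/measurable_EFinP.
  - by move=> k w _; rewrite lee_fin.
  apply: (@le_lt_trans _ _ (K / (a * theta - b))%:E); last by rewrite ltry.
  apply: lime_le.
    by apply: is_cvg_nneseries => k _ _; rewrite alE lee_fin.
  apply: nearW => n; under eq_bigr do rewrite alE.
  by rewrite sumEFin lee_fin.
have := integrable_ae measurableT itot; apply: filterS => w /(_ I) wfin.
exists (fine (\sum_(0 <= k <oo) (tot k w)%:E)%E) => n.
rewrite -lee_fin fineK// -sumEFin.
by apply: nneseries_lim_ge => k _ _; rewrite lee_fin.
Qed.

End Summability.

(** * Uniqueness of the smooth proximal step, signs of the constants, and the convergence theorem *)

Lemma prox_smooth_unique (R : realType) (p : nat) (f : 'rV[R]_p -> R)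
    (gamma L : R) (u u' : 'rV[R]_p) : 0 <= gamma * L -> gamma * L < 1 ->
  L_smooth L f ->
  u + gamma *: gradient f u = u' + gamma *: gradient f u' -> u = u'.
Proof.
move=> x0 x1 fL e.
have De : u - u' = - (gamma *: (gradient f u - gradient f u')).
  apply/rowP => j; move/rowP : e => /(_ j); rewrite !mxE => e; lra.
apply/eqP; rewrite -subr_eq0; apply/eqP; apply: dotv_eq0.
have h : dotv (u - u') (u - u') <= (gamma * L) ^+ 2 * dotv (u - u') (u - u').
  rewrite {1 2}De dotvNl dotvNr opprK dotvZl dotvZr mulrA -expr2 exprMn.
  rewrite -[leRHS]mulrA ler_wpM2l ?sqr_ge0//; exact: L_smooth_sqr.
have x2 : (gamma * L) ^+ 2 < 1 by rewrite expr_lt1.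
apply/eqP; rewrite eq_le dotv_ge0 andbT leNgt; apply/negP => D0.
have : (gamma * L) ^+ 2 * dotv (u - u') (u - u') < 1 * dotv (u - u') (u - u').
  by rewrite ltr_pM2r.
by rewrite mul1r ltNge h.
Qed.

Lemma L_smooth_ge0 (R : realType) (p : nat) (f : 'rV[R]_p -> R) (L : R) :
  (0 < p)%N -> L_smooth L f -> 0 <= L.
Proof.
move=> p0 [_ /(_ (delta_mx 0 (Ordinal p0)) 0)]; rewrite subr0 => h.
have d0 : 0 < enorm (delta_mx 0 (Ordinal p0) : 'rV[R]_p).
  apply: enorm_gt0; apply/eqP => /rowP/(_ (Ordinal p0)).
  by rewrite !mxE !eqxx /= => /eqP; rewrite oner_eq0.
by rewrite -(pmulr_lge0 L d0); exact: le_trans (enorm_ge0 _) h.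
Qed.

(** The upper and lower quadratic models of [f] at the same pair of points differ by [(L + l) / 2]
    times a positive square. *)
Lemma smooth_hypoconvex_ge0 (R : realType) (p : nat) (f : 'rV[R]_p -> R) (L l : R) :
  (0 < p)%N -> 0 <= L -> L_smooth L f ->
  (forall x y, f x + dotv (gradient f x) (y - x) - l / 2 * dotv (y - x) (y - x) <= f y) ->
  0 <= L + l.
Proof.
move=> p0 L0 fL lb; pose e : 'rV[R]_p := delta_mx 0 (Ordinal p0).
have d0 : 0 < dotv e e.
  rewrite -sqr_enorm exprn_gt0// enorm_gt0//; apply/eqP => /rowP/(_ (Ordinal p0)).
  by rewrite !mxE !eqxx /= => /eqP; rewrite oner_eq0.
have := lb 0 e; have := descent_lemma 0 e L0 fL; rewrite subr0 => h1 h2.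
rewrite -(pmulr_lge0 _ d0); lra.
Qed.

Theorem mainTheorem2 (R : realType) (p : nat)
    (d : measure_display) (T : measurableType d) (P : probability T R)
    (f : 'rV[R]_p -> R) (g phi : 'rV[R]_p -> \bar R) (L l delta gamma : R)
    (c : nat) (s0 : 'rV[R]_p) (u v s : nat -> T -> 'rV[R]_p)
    (C : nat -> T -> {set 'I_p})
    (phiE : phi = (fun x => (f x)%:E + g x)%E)
    (phi_lb : lower_bounded phi)
    (phi_min : argmin phi !=set0)
    (f_smooth : L_smooth L f)
    (f_hypoconvex : convex_function setT (fun x => f x + l / 2 * enorm x ^+ 2))
    (g_proper : proper_efun g)
    (g_lsc : lower_semicontinuous g)
    (g_proxb : prox_bounded g)
    (delta_gt0 : 0 < delta)
    (c_lb : p%:R / 2 + delta < c%:R)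
    (c_ub : (c <= p)%N)
    (gamma_gt0 : 0 < gamma)
    (gamma_small :
      (1 + gamma * L) ^+ 2 + gamma * L ^+ 2 + 5 * gamma * l / 2
      + (1 + gamma) * (1 + gamma * l) ^+ 2 * (1 - c%:R / p%:R) - 3 / 2 < 0)
    (drs : rand_DRS P f g gamma c s0 u v s C) :
  [/\ {ae P, forall w, exists Lstar : R,
         Lagr f g gamma (u k w) (v k w) (s k w) @[k --> \oo] --> Lstar%:E},
      {ae P, forall w,
         (\sum_(1 <= k <oo) (enorm (v k w - u k w) ^+ 2)%:E < +oo)%E} &
      {ae P, forall w,
         cluster (v k w @[k --> \oo]) = cluster (u k w @[k --> \oo]) /\
         cluster (u k w @[k --> \oo]) `<=` stationary phi}].
Proof.
have p0 : (0 < p)%N.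
  by rewrite lt0n; apply/eqP => pE; subst p; move: c_ub c_lb; rewrite leqn0 => /eqP->; lra.
have pR : 0 < p%:R :> R by rewrite ltr0n.
have L0 := L_smooth_ge0 p0 f_smooth.
have lb x y : f x + dotv (gradient f x) (y - x) - l / 2 * dotv (y - x) (y - x) <= f y.
  by apply: hypoconvex_lower_bound => //; exact: f_smooth.1.
have Ll := smooth_hypoconvex_ge0 p0 L0 f_smooth lb.
have cp1 : c%:R / p%:R <= 1 :> R by rewrite ler_pdivrMr// mul1r ler_nat.
have cp2 : 1 / 2 < c%:R / p%:R :> R by rewrite ltr_pdivlMr//; lra.
have q0 : 0 <= 1 - c%:R / p%:R :> R by rewrite subr_ge0.
have [x1 mu0 B0 c21] := step_size_bounds gamma_gt0 L0 Ll q0 gamma_small.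
have [m phim] := phi_lb.
have phi_ge x : (m%:E <= (f x)%:E + g x)%E by have := phim x; rewrite phiE.
pose U w k := u k.+1 w; pose V w k := v k.+1 w; pose S w k := s k w.
pose CC w k := C k.+1 w.
have pU w k : prox gamma (EFin \o f) (S w k) (U w k) by exact: drs_u drs k w.
have pV w k : prox gamma g (2 *: U w k - S w k) (V w k) by exact: drs_v drs k w.
have sS w k : S w k.+1 = S w k + \sum_(j in CC w k) (V w k - U w k) 0 j *: delta_mx 0 j.
  exact: drs_s drs k w.
pose tot k w := \sum_j (V w k - U w k) 0 j ^+ 2.
pose rho k w := \sum_(j in CC w k) (V w k - U w k) 0 j ^+ 2.
pose En w k := envelope f (fine (g (V w k))) gamma (U w k) (V w k).
have tot0 k w : 0 <= tot k w by apply: sumr_ge0 => j _; exact: sqr_ge0.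
have rho0 k w : 0 <= rho k w by apply: sumr_ge0 => j _; exact: sqr_ge0.
pose S0 := (gamma * L + gamma * l) / 2.
pose mu := 1 + (gamma * L - gamma * l) / 2.
pose B := 1 / 2 - gamma * l / 2 - (gamma * L) ^+ 2 - S0.
pose c1 := B / (1 + gamma * L) ^+ 2; pose c2 := S0 / mu ^+ 2.
have gL0 : 0 <= gamma * L by rewrite mulr_ge0// ltW.
have c1_gt0 : 0 < c1 by rewrite divr_gt0// exprn_gt0// ltr_wpDr.
have c2_ge0 : 0 <= c2 by rewrite divr_ge0 ?sqr_ge0// divr_ge0// -mulrDr mulr_ge0// ltW.
(* The initial energy is the same constant bound on every path: [s0] is fixed and the smooth
   proximal step is single-valued, so the first [u] is deterministic, and all choices of the first
   [v] minimise the same objective. [point] is an arbitrary reference outcome. *)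
have En0 w : En w 0%N <= En point 0%N.
  have SU w' : S w' 0%N = U w' 0%N + gamma *: gradient f (U w' 0%N).
    exact: prox_smooth_gradient f_smooth (pU w' 0%N).
  have UE : U w 0%N = U point 0%N.
    by apply: (prox_smooth_unique gL0 x1 f_smooth); rewrite -!SU /S !(drs_init drs).
  rewrite /En -UE; apply: (envelope_min _ (SU w)); first by rewrite gt_eqF.
  have := pV w 0%N (V point 0%N).
  rewrite -(fineK (prox_fin_num g_proper (pV w 0%N))).
  by rewrite -(fineK (prox_fin_num g_proper (pV point 0%N))) -!EFinD lee_fin.
have lbE w k : m + (2 * gamma)^-1 * (1 - gamma * L) * tot k w <= En w k.
  exact: (energy_lb gamma_gt0 L0 f_smooth g_proper phi_ge (pV w)).
have stepE w k : En w k.+1 <= En w k + c2 / gamma * tot k w.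
  exact: (energy_step_le gamma_gt0 L0 Ll f_smooth g_proper lb mu0 B0 (pU w) (pV w) (sS w)).
(* Supplies finiteness of the expectations: by induction the energy at each fixed [k] is bounded
   uniformly over outcomes, and the energy controls the residual. *)
have totA : exists A : nat -> R, forall k w, tot k w <= A k.
  pose t := (2 * gamma)^-1 * (1 - gamma * L).
  have t0 : 0 < t by rewrite mulr_gt0 ?subr_gt0// invr_gt0 mulr_gt0.
  have tot_of_En k w a : En w k <= a -> tot k w <= t^-1 * (a - m).
    by move=> Ea; rewrite ler_pdivlMl//; have := lbE w k; rewrite -/t; lra.
  suff EA k : exists a, forall w, En w k <= a.
    have [A hA] := choice EA.
    by exists (fun k => t^-1 * (A k - m)) => k w; exact: tot_of_En.
  elim: k => [|k [a IH]]; first by exists (En point 0%N).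
  exists (a + c2 / gamma * (t^-1 * (a - m))) => w.
  apply: le_trans (stepE w k) _; apply: lerD; first exact: IH.
  apply: ler_wpM2l; first by rewrite divr_ge0// ltW.
  exact: tot_of_En.
have [A hA] := totA.
have mtot k : measurable_fun setT (tot k).
  rewrite (_ : tot k = fun w => \sum_(j in [set: 'I_p]%SET) (v k.+1 w - u k.+1 w) 0 j ^+ 2).
    by apply: measurable_residual; [exact: drs_meas_u drs k|exact: drs_meas_v drs k].
  by apply/funext => w; apply: eq_bigl => j; rewrite finset.in_setT.
have mrho k : measurable_fun setT (rho k).
  apply: (measurable_sampled_sum (C := C k.+1)
    (X := fun j w => (v k.+1 w - u k.+1 w) 0 j ^+ 2)) => [j|S']; last exact: drs_meas_C drs k S'.
  rewrite (_ : (fun _ => _) = fun w => (v k.+1 w 0 j - u k.+1 w 0 j) ^+ 2).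
    by apply: measurable_funX; apply: measurable_funB; [exact: drs_meas_v drs k j|exact: drs_meas_u drs k j].
  by apply/funext => w; rewrite !mxE.
have summ : {ae P, forall w, exists M, forall n, \sum_(0 <= k < n) tot k w <= M}.
  apply: (@ae_bounded_series _ _ _ P rho tot A (c%:R / p%:R) (c1 + c2) c2
    (gamma * (En point 0%N - m))) => //.
  - by move=> k; exact: integral_updated_residual drs k p0 c_ub.
  - by rewrite addr_ge0// ltW.
  - apply: mulr_ge0; first exact: ltW.
    by rewrite subr_ge0; exact: (m_le_energy gamma_gt0 L0 f_smooth g_proper phi_ge x1 (pV point)).
  (* Here the majority of updated coordinates enters: [c2 <= (c1 + c2) / 2 < (c1 + c2) * (c /
     p)]. *)
  - have c12 : 0 < c1 + c2 by rewrite ltr_wpDr.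
    have h : (c1 + c2) * (1 / 2) < (c1 + c2) * (c%:R / p%:R) by rewrite ltr_pM2l.
    by apply: le_lt_trans h; move: c21; rewrite -/S0 -/mu -/B -/c1 -/c2; lra.
  - move=> n w.
    apply: le_trans (energy_telescope gamma_gt0 L0 Ll f_smooth g_proper lb phi_ge x1 mu0 B0
      (pU w) (pV w) (sS w) n) _.
    by rewrite lerD2r ler_pM2l// lerB// En0.
(* From here on nothing is random: all three conclusions hold on each path with bounded partial
   sums. *)
have limM w M : (forall n, \sum_(0 <= k < n) tot k w <= M) -> [/\
    exists Lstar : R, Lagr f g gamma (u k w) (v k w) (s k w) @[k --> \oo] --> Lstar%:E,
    (\sum_(1 <= k <oo) (enorm (v k w - u k w) ^+ 2)%:E < +oo)%E &
    cluster (v k w @[k --> \oo]) = cluster (u k w @[k --> \oo]) /\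
    cluster (u k w @[k --> \oo]) `<=` stationary phi].
  move=> hM; split.
  - have [Ls hLs] := Lagr_cvg gamma_gt0 L0 Ll f_smooth g_proper lb phi_ge x1 mu0 B0
      (pU w) (pV w) (sS w) hM.
    by exists Ls; rewrite -cvg_shiftS; exact: hLs.
  - apply: (@le_lt_trans _ _ M%:E); last by rewrite ltry.
    apply: lime_le.
      by apply: is_cvg_nneseries => k _ _; rewrite lee_fin sqr_ge0.
    apply: nearW => -[|n]; first by rewrite big_geq// lee_fin (le_trans _ (hM 0%N))// big_geq.
    rewrite big_add1/= sumEFin lee_fin; apply: le_trans (hM n).
    apply: ler_sum => k _; rewrite sqr_enorm.
    by apply: ler_sum => j _; rewrite expr2.
  - have rc : v k w - u k w @[k --> \oo] --> (0 : 'rV[R]_p).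
      rewrite -(cvg_shiftS (fun k => v k w - u k w)).
      exact: (@residual_cvg0 _ _ (U w) (V w) M hM).
    split.
      apply/seteqP; split; last exact: cluster_sub_vanishing rc.
      apply: cluster_sub_vanishing.
      rewrite (_ : (fun k => _) = - (fun k => v k w - u k w)); last first.
        by apply/funext => k; rewrite fctE opprB.
      by rewrite -[X in _ --> X]oppr0; exact: cvgN.
    move=> x /cluster_subseq[sub sub_gt subx].
    (* The predecessor undoes the shift [U w k = u k.+1 w]; it is harmless because [sub n > n]. *)
    rewrite phiE; apply: (@subseq_limit_stationary _ _ f g gamma L l gamma_gt0 L0 f_smooth
      g_proper lb g_lsc (U w) (V w) (S w) (pU w) (pV w) M hM (fun n => (sub n).-1)).
      by move=> n; have := sub_gt n; case: (sub n).
    rewrite (_ : (fun n => _) = fun n => u (sub n) w)//.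
    by apply/funext => n; rewrite /U prednK// (leq_ltn_trans _ (sub_gt n)).
split; apply: filterS summ => w [M hM]; by have [] := limM w M hM.
Qed.
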